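(* Let $\alpha,\beta,m,n$ be integers. Then for all $\tau\in\mathbb{H}$ and $z$ with $\theta_1(z|\tau)\ne0$, $$\theta'[{}^{\alpha}_{\beta}]\Big(z+\frac n2+\frac m2\tau\Big|\tau\Big)=\frac{i^{-m(\beta+n)}e^{-\frac14\pi im(4z+m\tau)}}{\theta_1(z|\tau)}\Big\{\big(\theta_1'(z|\tau)-\pi im\,\theta_1(z|\tau)\big)\theta[{}^{\alpha+m}_{\beta+n}](z|\tau)-\big\langle(\alpha+m)\big[\tfrac{\beta+n}{2}\big]\big\rangle\,\pi\,\vartheta[{}^{\alpha+m}_{\beta+n}](\tau)^2\,\theta[{}^{\alpha+m-1}_{\ \ 0}](z|\tau)\,\theta[{}^{\ \ 0}_{\beta+n-1}](z|\tau)\Big\}.$$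
   Context: $\mathbb{H}=\{\Im\tau>0\}$. For integers $\alpha,\beta$: $\theta[{}^{\alpha}_{\beta}](z|\tau)=\sum_{k\in\mathbb{Z}}\exp\big(\pi i(k+\tfrac\alpha2)^2\tau+2\pi i(k+\tfrac\alpha2)(z+\tfrac\beta2)\big)$, $\theta'[{}^{\alpha}_{\beta}]=\partial_z\theta[{}^{\alpha}_{\beta}]$, $\vartheta[{}^{\alpha}_{\beta}](\tau)=\theta[{}^{\alpha}_{\beta}](0|\tau)$. $\theta_1:=-\theta[{}^1_1]$ and $\theta_1'=\partial_z\theta_1$. $[x]$ denotes the integer part of $x$ and $\langle x\rangle=(-1)^x$. *)

(* Defs.v *)
From Stdlib Require Import Reals ZArith ClassicalEpsilon.
From Coquelicot Require Import Coquelicot.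
Open Scope C_scope.

Definition cexp (w : C) : C :=
  (exp (Re w) * cos (Im w), exp (Re w) * sin (Im w))%R.

Fixpoint Cpown (x : C) (n : nat) : C :=
  match n with O => 1 | S k => x * Cpown x k end.
Definition Cpowz (x : C) (k : Z) : C :=
  match k with
  | Z0 => 1
  | Zpos p => Cpown x (Pos.to_nat p)
  | Zneg p => / Cpown x (Pos.to_nat p)
  end.

Definition sgnZ (k : Z) : C := if Z.even k then 1 else -1.

Definition Csum (a : nat -> C) : C :=
  (Series (fun n => Re (a n)), Series (fun n => Im (a n))).

Definition Zsum (f : Z -> C) : C :=
  Csum (fun n => f (Z.of_nat n) + f (- Z.of_nat n - 1)%Z).

(* complex derivative (value of l with is_derive f z l over C, if it exists) *)
Definition Cderiv (f : C -> C) (z : C) : C :=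
  epsilon (inhabits (RtoC 0)) (fun l : C => @is_derive C_AbsRing C_NormedModule f z l).

Definition theta (a b : Z) (z tau : C) : C :=
  Zsum (fun k =>
    let q : C := RtoC (IZR k + IZR a / 2) in
    cexp (RtoC PI * Ci * q * q * tau
          + 2 * RtoC PI * Ci * q * (z + RtoC (IZR b / 2)))).

Definition theta' (a b : Z) (z tau : C) : C :=
  Cderiv (fun w => theta a b w tau) z.

Definition vartheta (a b : Z) (tau : C) : C := theta a b 0 tau.

Definition theta1 (z tau : C) : C := - theta 1 1 z tau.
Definition theta1' (z tau : C) : C := Cderiv (fun w => theta1 w tau) z.

(* Main.v *)
Require Import Defs.
From Stdlib Require Import Reals ZArith Lra Lia ClassicalEpsilon.
From Coquelicot Require Import Coquelicot.
Open Scope C_scope.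

(** Shifting [z] by half periods shifts the characteristic term by term, which
    reduces the claim to the formula
    [theta1' thetaX - theta1 thetaX' = pi varthetaX^2 thetaY thetaZ]
    with [{X,Y,Z} = {2,3,4}].  Summing a product of two theta series along the
    diagonals [k - l = d] expresses both sides through theta series at [2 tau];
    splitting by the parity of [d] shows that they are proportional as functions of
    [z].  The factor is read off at [z = 0] from Jacobi's formula
    [vartheta1' = pi vartheta2 vartheta3 vartheta4].  The same product formulas show
    that the quotient of the two sides of Jacobi's formula is invariant under
    [tau -> 2 tau]; its limit along [2^n tau] is 1.  The nonvanishing of the
    theta constants descends from the cusp in the same way. *)

(** * The complex exponential *)

(** The usual route divides two theta expressions and argues that a doubly periodic function without
    poles is constant. Here every step is an identity or an estimate for absolutely convergent sums,
    so the diagonal product formula has to do that work. It produces one term per parity, hence two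
    functions of [z], and proportionality needs a reason in each case. For [X = 2] one of the two
    constants is the value at zero of the odd function [theta1], or of the derivative of the even
    function [theta4], and vanishes. For [X = 3, 4] quarter characteristics appear at [2 tau], and
    the reflection exchanging [1/4] and [3/4] ties the two constants together; this is why [Theta]
    takes a real characteristic. The factors are never computed, only their ratio matters: at
    [z = 0], where [theta1] vanishes, the Wronskian reduces to [theta1' thetaX], and dividing by the
    other product there requires nonzero theta constants. When [X] is [theta1] itself, both sides
    vanish. Derivatives are picked by [epsilon], so a quadratic remainder estimate must come before
    any of them can be identified. *)

Lemma im_le_Cmod (c : C) : (Rabs (Im c) <= Cmod c)%R.
Proof.
  rewrite <- (Rabs_pos_eq (Cmod c)) by apply Cmod_ge_0.
  apply Rsqr_le_abs_0; unfold Rsqr.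
  generalize (Cmod2_alt c); simpl; nra.
Qed.

Lemma Cmod_Ci : Cmod Ci = 1%R.
Proof.
  unfold Cmod; simpl; replace (_ + _)%R with 1%R by ring; exact sqrt_1.
Qed.

Lemma cexp_plus (u v : C) : cexp (u + v) = cexp u * cexp v.
Proof.
  destruct u as [a b], v as [c d]; unfold cexp; simpl.
  rewrite exp_plus, cos_plus, sin_plus.
  apply injective_projections; simpl; ring.
Qed.

Lemma cexp_0 : cexp 0 = 1.
Proof.
  unfold cexp; simpl; rewrite exp_0, cos_0, sin_0.
  apply injective_projections; simpl; ring.
Qed.

Lemma Cmod_cexp (w : C) : Cmod (cexp w) = exp (Re w).
Proof.
  unfold Cmod, cexp; simpl.
  replace (_ + _)%R with (exp (Re w) * exp (Re w))%R.
  - apply sqrt_square, Rlt_le, exp_pos.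
  - generalize (sin2_cos2 (Im w)); unfold Rsqr; intros H; nra.
Qed.

Lemma cexp_neq_0 (w : C) : cexp w <> 0.
Proof.
  intros H; generalize (Cmod_cexp w); rewrite H, Cmod_0.
  generalize (exp_pos (Re w)); lra.
Qed.

Lemma cexp_opp (w : C) : cexp (- w) = / cexp w.
Proof.
  assert (H : cexp (- w) * cexp w = 1).
  { rewrite <- cexp_plus; replace (- w + w) with (RtoC 0) by ring; apply cexp_0. }
  generalize (cexp_neq_0 w); intros Hw.
  rewrite <- (Cmult_1_l (/ cexp w)), <- H; field; exact Hw.
Qed.

Lemma cexp_quarter : cexp (RtoC PI * Ci / 2) = Ci.
Proof.
  unfold cexp; simpl.
  match goal with |- (exp ?x * cos ?y, _)%R = _ =>
    replace x with 0%R by (field; lra); replace y with (PI / 2)%R by (field; lra) end.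
  rewrite exp_0, cos_PI2, sin_PI2.
  apply injective_projections; simpl; ring.
Qed.

Lemma cexp_half : cexp (RtoC PI * Ci) = -1.
Proof.
  replace (RtoC PI * Ci) with (RtoC PI * Ci / 2 + RtoC PI * Ci / 2).
  - rewrite cexp_plus, cexp_quarter.
    apply injective_projections; simpl; ring.
  - field.
Qed.

(** Turns the power of [i] in the theorem into an exponential, so that it merges with the other
    phases through [cexp_plus]. *)
Lemma cexp_Zquarter (k : Z) :
  Cpowz Ci k = cexp (RtoC PI * Ci * RtoC (IZR k / 2)).
Proof.
  assert (Hn : forall n, Cpown Ci n = cexp (RtoC PI * Ci * RtoC (INR n / 2))).
  { induction n as [|n IH].
    - simpl. rewrite <- cexp_0; f_equal.
      apply injective_projections; simpl; field.
    - change (Cpown Ci (S n)) with (Ci * Cpown Ci n).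
      rewrite IH, <- cexp_quarter at 1.
      rewrite <- cexp_plus; f_equal; rewrite S_INR.
      apply injective_projections; simpl; field. }
  destruct k as [|p|p]; simpl.
  - rewrite <- cexp_0; f_equal; apply injective_projections; simpl; field.
  - rewrite Hn, INR_IZR_INZ, positive_nat_Z; reflexivity.
  - rewrite Hn, INR_IZR_INZ, positive_nat_Z, <- cexp_opp; f_equal.
    change (Z.neg p) with (- Z.pos p)%Z; rewrite opp_IZR.
    apply injective_projections; simpl; field.
Qed.

Lemma cexp_Zhalf (k : Z) : cexp (RtoC PI * Ci * RtoC (IZR k)) = sgnZ k.
Proof.
  replace (RtoC PI * Ci * RtoC (IZR k)) with (RtoC PI * Ci * RtoC (IZR (2 * k) / 2)).
  2: { rewrite mult_IZR; apply injective_projections; simpl; field. }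
  rewrite <- cexp_Zquarter.
  assert (H2 : forall j, Cpowz Ci (2 * (2 * j)) = 1).
  { intros j; rewrite cexp_Zquarter, (mult_IZR 2 (2 * j)), (mult_IZR 2 j).
    unfold cexp; simpl.
    match goal with |- (exp ?x * cos ?y, _)%R = _ =>
      replace x with 0%R by (field; lra);
      replace y with (0 + 2 * IZR j * PI)%R by
        field end.
    assert (Hsc : (cos (0 + 2 * IZR j * PI) = 1 /\ sin (0 + 2 * IZR j * PI) = 0)%R).
    { destruct (Z_le_gt_dec 0 j) as [Hj|Hj].
      - rewrite <- (Z2Nat.id j Hj), <- INR_IZR_INZ, cos_period, sin_period, cos_0, sin_0; auto.
      - set (p := Z.to_nat (- j)).
        assert (Hp : IZR j = (- INR p)%R).
        { unfold p; rewrite INR_IZR_INZ, Z2Nat.id, opp_IZR by lia; ring. }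
        (* The period lemmas take a natural number of turns; for negative [j] they are applied at
           the far point, from which [p] turns lead back to 0. *)
        generalize (cos_period (0 + 2 * IZR j * PI) p) (sin_period (0 + 2 * IZR j * PI) p).
        rewrite Hp; replace (0 + 2 * - INR p * PI + 2 * INR p * PI)%R with 0%R by ring.
        rewrite cos_0, sin_0; auto. }
    destruct Hsc as [-> ->]; rewrite exp_0.
    apply injective_projections; simpl; ring. }
  unfold sgnZ; destruct (Z.even k) eqn:E.
  - apply Z.even_spec in E; destruct E as [j ->]; apply H2.
  - assert (O : Z.odd k = true) by (rewrite <- Z.negb_even, E; reflexivity).
    apply Z.odd_spec in O; destruct O as [j ->].
    rewrite cexp_Zquarter.
    replace (RtoC PI * Ci * RtoC (IZR (2 * (2 * j + 1)) / 2))
      with (RtoC PI * Ci * RtoC (IZR (2 * (2 * j)) / 2) + RtoC PI * Ci).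
    + rewrite cexp_plus, <- cexp_Zquarter, H2, cexp_half; ring.
    + rewrite !mult_IZR, plus_IZR, mult_IZR.
      apply injective_projections; simpl; field.
Qed.

Lemma Rabs_le_exp (x : R) : (Rabs x <= exp (Rabs x))%R.
Proof.
  generalize (exp_ineq1_le (Rabs x)); lra.
Qed.

(** Comes from [1 + t <= exp t] at [t = x] and at [t = - x], the latter multiplied by [exp x]. *)
Lemma exp_remainder1 (x : R) : (Rabs (exp x - 1) <= Rabs x * exp (Rabs x))%R.
Proof.
  assert (H1 := exp_ineq1_le x). assert (H2 := exp_ineq1_le (- x)).
  assert (E : (exp x * exp (- x) = 1)%R)
    by (rewrite <- exp_plus; replace (x + - x)%R with 0%R by ring; apply exp_0).
  assert (P := exp_pos x).
  destruct (Rle_dec 0 x) as [H|H].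
  - rewrite (Rabs_pos_eq x) by lra. rewrite Rabs_pos_eq by lra. nra.
  - rewrite (Rabs_left x) by lra.
    assert (exp x <= 1)%R by (rewrite <- exp_0; left; apply exp_increasing; lra).
    rewrite Rabs_left1 by lra. nra.
Qed.

Lemma exp_remainder2 (x : R) : (Rabs (exp x - 1 - x) <= x * x * exp (Rabs x))%R.
Proof.
  assert (H1 := exp_ineq1_le x). assert (H2 := exp_ineq1_le (- x)).
  assert (H3 := exp_remainder1 x).
  assert (E : (exp x * exp (- x) = 1)%R)
    by (rewrite <- exp_plus; replace (x + - x)%R with 0%R by ring; apply exp_0).
  assert (P := exp_pos x).
  assert (K : (exp x - 1 <= x * exp x)%R).
  { assert (L := Rmult_le_compat_l _ _ _ (Rlt_le _ _ P) H2); lra. }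
  rewrite Rabs_pos_eq by lra.
  assert (K' : (exp x - 1 - x <= x * (exp x - 1))%R) by lra.
  destruct (Rle_dec 0 x) as [H|H].
  - rewrite (Rabs_pos_eq x) by lra.
    assert (L := Rmult_le_compat_l _ _ _ H K); lra.
  - rewrite (Rabs_left x) by lra.
    assert (x * (exp x - 1) <= x * x)%R by nra.
    assert (0 <= x * x)%R by nra.
    assert (1 <= exp (- x))%R by lra.
    nra.
Qed.

Lemma cos_remainder (y : R) : (Rabs (cos y - 1) <= y * y)%R.
Proof.
  assert (B := COS_bound y).
  rewrite Rabs_left1 by lra.
  replace y with (2 * (y / 2))%R at 1 by field.
  rewrite cos_2a_sin.
  assert (Hs : (Rabs (sin (y / 2)) <= Rabs (y / 2))%R).
  { destruct (MVT_cor4 sin cos 0 (Rabs (y/2)) ) with (b := (y/2)%R) as [c [Hc _]].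
    - intros c _; apply is_derive_Reals, derivable_pt_lim_sin.
    - rewrite Rminus_0_r; lra.
    - rewrite sin_0, !Rminus_0_r in Hc; rewrite Hc, Rabs_mult.
      assert (Rabs (cos c) <= 1)%R by (apply Rabs_le, COS_bound).
      generalize (Rabs_pos (y/2)); nra. }
  assert (Hq : (sin (y/2) * sin (y/2) <= (y/2) * (y/2))%R).
  { apply Rsqr_le_abs_1 in Hs; exact Hs. }
  nra.
Qed.

(** Mean value theorem for [sin t - t], whose derivative [cos t - 1] is itself at most [|t|] by a
    second mean value argument. Order two is all that [cexp_remainder] requires. *)
Lemma sin_remainder (y : R) : (Rabs (sin y - y) <= y * y)%R.
Proof.
  destruct (MVT_cor4 (fun t => sin t - t)%R (fun t => cos t - 1)%R 0 (Rabs y)) with (b := y)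
    as [c [Hc Hb]].
  - intros c _; apply is_derive_Reals, (derivable_pt_lim_minus sin id).
    + apply derivable_pt_lim_sin.
    + apply derivable_pt_lim_id.
  - rewrite Rminus_0_r; lra.
  - rewrite sin_0, !Rminus_0_r in Hc; rewrite Hc, Rabs_mult.
    rewrite !Rminus_0_r in Hb.
    assert (Hs : (Rabs (cos c - 1) <= Rabs y)%R).
    { destruct (MVT_cor4 cos (fun t => - sin t)%R 0 (Rabs c)) with (b := c) as [d [Hd _]].
      - intros e _; apply is_derive_Reals, derivable_pt_lim_cos.
      - rewrite Rminus_0_r; lra.
      - rewrite cos_0, Rminus_0_r in Hd; rewrite Hd, Rabs_mult, Rabs_Ropp.
        assert (Rabs (sin d) <= 1)%R by (apply Rabs_le, SIN_bound).
        assert (Rabs (sin d) * Rabs c <= 1 * Rabs c)%R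
          by (apply Rmult_le_compat_r; [apply Rabs_pos | assumption]).
        lra. }
    replace (y * y)%R with (Rabs y * Rabs y)%R.
    + apply Rmult_le_compat_r; [apply Rabs_pos | exact Hs].
    + rewrite <- Rabs_mult; apply Rabs_pos_eq; nra.
Qed.

(** The remainder splits into four real pieces, two in the real part and two in the imaginary part,
    each at most [M * M * exp M]. The constant 5 leaves slack. *)
Lemma cexp_remainder (u : C) :
  (Cmod (cexp u - 1 - u) <= 5 * (Cmod u * Cmod u) * exp (Cmod u))%R.
Proof.
  destruct u as [x y].
  set (M := Cmod (x, y)).
  assert (Hx : (Rabs x <= M)%R) by (apply (re_le_Cmod (x, y))).
  assert (Hy : (Rabs y <= M)%R) by (apply (im_le_Cmod (x, y))).
  assert (Hex : (exp (Rabs x) <= exp M)%R)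
    by (destruct Hx as [Hx| ->]; [left; apply exp_increasing; exact Hx | right; reflexivity]).
  assert (Hex' : (exp x <= exp M)%R).
  { apply Rle_trans with (2 := Hex). generalize (Rle_abs x); intros [H|H].
    left; apply exp_increasing; exact H. rewrite H at 1; right; reflexivity. }
  assert (R1 := exp_remainder1 x). assert (R2 := exp_remainder2 x).
  assert (R3 := cos_remainder y). assert (R4 := sin_remainder y).
  assert (P := exp_pos x). assert (PM := exp_pos M). assert (PX := exp_pos (Rabs x)).
  assert (Px := Rabs_pos x). assert (Py := Rabs_pos y).
  assert (Ex : (x * x = Rabs x * Rabs x)%R)
    by (rewrite <- Rabs_mult; symmetry; apply Rabs_pos_eq; nra).
  assert (Ey : (y * y = Rabs y * Rabs y)%R)
    by (rewrite <- Rabs_mult; symmetry; apply Rabs_pos_eq; nra).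
  rewrite Ex in R2. rewrite Ey in R3, R4.
  assert (xx : (Rabs x * Rabs x <= M * M)%R) by nra.
  assert (yy : (Rabs y * Rabs y <= M * M)%R) by nra.
  assert (xy : (Rabs x * Rabs y <= M * M)%R) by nra.
  assert (A : (Rabs (exp x * (cos y - 1)) <= M * M * exp M)%R).
  { rewrite Rabs_mult, (Rabs_pos_eq (exp x)) by lra.
    rewrite Rmult_comm; apply Rmult_le_compat; try lra; try apply Rabs_pos. }
  assert (B : (Rabs (exp x - 1 - x) <= M * M * exp M)%R).
  { eapply Rle_trans; [exact R2|]. apply Rmult_le_compat; try lra; nra. }
  assert (D : (Rabs (exp x * (sin y - y)) <= M * M * exp M)%R).
  { rewrite Rabs_mult, (Rabs_pos_eq (exp x)) by lra.
    rewrite Rmult_comm; apply Rmult_le_compat; try lra; try apply Rabs_pos. }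
  assert (F : (Rabs ((exp x - 1) * y) <= M * M * exp M)%R).
  { rewrite Rabs_mult.
    apply Rle_trans with ((Rabs x * exp (Rabs x)) * Rabs y)%R.
    - apply Rmult_le_compat_r; lra.
    - replace (Rabs x * exp (Rabs x) * Rabs y)%R with (Rabs x * Rabs y * exp (Rabs x))%R by ring.
      apply Rmult_le_compat; try lra; nra. }
  replace (cexp (x, y) - 1 - (x, y)) with
    (RtoC (exp x * (cos y - 1) + (exp x - 1 - x)) +
     Ci * RtoC (exp x * (sin y - y) + (exp x - 1) * y)).
  2: { unfold cexp; simpl; apply injective_projections; simpl; ring. }
  eapply Rle_trans; [apply Cmod_triangle|].
  rewrite Cmod_mult, !Cmod_R.
  rewrite Cmod_Ci.
  assert (N : (0 <= M * M * exp M)%R) by (apply Rmult_le_pos; nra).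
  generalize (Rabs_triang (exp x * (cos y - 1)) (exp x - 1 - x))
    (Rabs_triang (exp x * (sin y - y)) ((exp x - 1) * y)).
  lra.
Qed.

(** * Absolutely convergent sums over the integers *)

Definition abs_summable (a : nat -> C) := ex_series (fun n => Cmod (a n)).

Lemma ex_series_dom (a b : nat -> R) :
  (forall n, Rabs (a n) <= b n)%R -> ex_series b -> ex_series a.
Proof. exact (ex_series_le a b). Qed.

Lemma Series_ge_0 (a : nat -> R) :
  (forall n, 0 <= a n)%R -> ex_series a -> (0 <= Series a)%R.
Proof.
  intros P H; rewrite <- (Rmult_0_l (Series a)), <- Series_scal_l.
  apply Series_le; [|exact H]. intros n; generalize (P n); lra.
Qed.

Lemma ex_series_Re (a : nat -> C) : abs_summable a -> ex_series (fun n => Re (a n)).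
Proof. apply ex_series_dom; intros n; apply re_le_Cmod. Qed.

Lemma ex_series_Im (a : nat -> C) : abs_summable a -> ex_series (fun n => Im (a n)).
Proof. apply ex_series_dom; intros n; apply im_le_Cmod. Qed.

Lemma abs_summable_le (a : nat -> C) (b : nat -> R) :
  (forall n, Cmod (a n) <= b n)%R -> ex_series b -> abs_summable a.
Proof.
  intros H; apply ex_series_dom; intros n.
  rewrite Rabs_pos_eq; [apply H | apply Cmod_ge_0].
Qed.

Lemma abs_summable_plus (a b : nat -> C) :
  abs_summable a -> abs_summable b -> abs_summable (fun n => a n + b n).
Proof.
  intros Ha Hb; apply abs_summable_le with (2 := ex_series_plus _ _ Ha Hb).
  intros n; apply Cmod_triangle.
Qed.

Lemma abs_summable_scal (c : C) (a : nat -> C) :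
  abs_summable a -> abs_summable (fun n => c * a n).
Proof.
  intros Ha; apply abs_summable_le with (2 := ex_series_scal_l (Cmod c) _ Ha).
  intros n; rewrite Cmod_mult; right; reflexivity.
Qed.

Lemma Csum_ext (a b : nat -> C) : (forall n, a n = b n) -> Csum a = Csum b.
Proof.
  intros H; unfold Csum; f_equal; apply Series_ext; intros n; rewrite H; reflexivity.
Qed.

Lemma Csum_plus (a b : nat -> C) :
  abs_summable a -> abs_summable b -> Csum (fun n => a n + b n) = Csum a + Csum b.
Proof.
  intros Ha Hb; unfold Csum; apply injective_projections; simpl;
    rewrite <- Series_plus; try apply Series_ext; auto using ex_series_Re, ex_series_Im.
Qed.

Lemma Csum_scal (c : C) (a : nat -> C) :
  abs_summable a -> Csum (fun n => c * a n) = c * Csum a.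
Proof.
  intros Ha; assert (HR := ex_series_Re _ Ha); assert (HI := ex_series_Im _ Ha).
  unfold Csum; destruct c as [x y]; apply injective_projections; simpl.
  - rewrite <- !Series_scal_l, <- Series_minus; try (apply (ex_series_scal_l (V := R_NormedModule)); assumption).
    apply Series_ext; intros n; reflexivity.
  - rewrite <- !Series_scal_l, <- Series_plus; try (apply (ex_series_scal_l (V := R_NormedModule)); assumption).
    apply Series_ext; intros n; reflexivity.
Qed.

(* Pairing the sum [S] with its own conjugate reduces the claim to the real
   estimate [Re (conj S * a n) <= |S| |a n|]. *)
Lemma Cmod_Csum_le (a : nat -> C) :
  abs_summable a -> (Cmod (Csum a) <= Series (fun n => Cmod (a n)))%R.
Proof.
  intros Ha; assert (HR := ex_series_Re _ Ha); assert (HI := ex_series_Im _ Ha).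
  assert (ER : Re (Csum a) = Series (fun n => Re (a n))) by reflexivity.
  assert (EI : Im (Csum a) = Series (fun n => Im (a n))) by reflexivity.
  revert ER EI; generalize (Csum a); intros S ER EI.
  assert (E : (Cmod S * Cmod S <= Cmod S * Series (fun n => Cmod (a n)))%R).
  { generalize (Cmod2_alt S); simpl; rewrite !Rmult_1_r; intros ->.
    rewrite <- (Series_scal_l (Cmod S)).
    replace (Re S * Re S + Im S * Im S)%R with
      (Series (fun n => Re S * Re (a n) + Im S * Im (a n)))%R.
    2: { rewrite Series_plus, !Series_scal_l;
         try (apply (ex_series_scal_l (V := R_NormedModule)); assumption).
         rewrite <- ER, <- EI; reflexivity. }
    assert (Hab : forall n, (Rabs (Re S * Re (a n) + Im S * Im (a n)) <= Cmod S * Cmod (a n))%R).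
    { intros n.
      replace (Re S * Re (a n) + Im S * Im (a n))%R with (Re (Cconj S * a n))
        by (destruct S, (a n); simpl; ring).
      eapply Rle_trans; [apply re_le_Cmod|].
      rewrite Cmod_mult, Cmod_conj; lra. }
    eapply Rle_trans; [apply Rle_abs|].
    assert (Hs : ex_series (fun n => (Cmod S * Cmod (a n))%R))
      by (apply (ex_series_scal_l (V := R_NormedModule)); exact Ha).
    eapply Rle_trans; [apply Series_Rabs|].
    - apply ex_series_dom with (2 := Hs); intros n; rewrite Rabs_Rabsolu; apply Hab.
    - apply Series_le; [|exact Hs]. intros n; split; [apply Rabs_pos | apply Hab]. }
  destruct (Cmod_ge_0 S) as [P|P].
  - apply Rmult_le_reg_l with (1 := P); exact E.
  - rewrite <- P; apply Series_ge_0; [intros n; apply Cmod_ge_0 | exact Ha].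
Qed.

(** The pairing built into [Zsum], for any operation, so that real majorants are folded in the same
    order as the complex sums they dominate. *)
Definition Zfold {A : Type} (op : A -> A -> A) (f : Z -> A) (n : nat) : A :=
  op (f (Z.of_nat n)) (f (- Z.of_nat n - 1)%Z).

Definition Zsummable_R (g : Z -> R) := ex_series (Zfold Rplus g).
Definition ZsumR (g : Z -> R) : R := Series (Zfold Rplus g).
Definition Zsummable (f : Z -> C) := Zsummable_R (fun k => Cmod (f k)).

Lemma Zsummable_half (f : Z -> C) :
  Zsummable f <->
  abs_summable (fun n => f (Z.of_nat n)) /\ abs_summable (fun n => f (- Z.of_nat n - 1)%Z).
Proof.
  split.
  - intros H; split; apply ex_series_dom with (2 := H); intros n; unfold Zfold;
      generalize (Cmod_ge_0 (f (Z.of_nat n))) (Cmod_ge_0 (f (- Z.of_nat n - 1)%Z)); intros;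
      rewrite Rabs_pos_eq; lra.
  - intros [H1 H2]; exact (ex_series_plus _ _ H1 H2).
Qed.

Lemma Zsummable_fold (f : Z -> C) :
  Zsummable f -> abs_summable (fun n => f (Z.of_nat n) + f (- Z.of_nat n - 1)%Z).
Proof. intros H; apply Zsummable_half in H; apply abs_summable_plus; apply H. Qed.

Lemma Zsum_half (f : Z -> C) :
  Zsummable f ->
  Zsum f = Csum (fun n => f (Z.of_nat n)) + Csum (fun n => f (- Z.of_nat n - 1)%Z).
Proof. intros H; apply Zsummable_half in H; apply Csum_plus; apply H. Qed.

Lemma Zsummable_le (f : Z -> C) (g : Z -> R) :
  (forall k, Cmod (f k) <= g k)%R -> Zsummable_R g -> Zsummable f.
Proof.
  intros H; apply ex_series_dom; intros n; unfold Zfold.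
  rewrite Rabs_pos_eq.
  - apply Rplus_le_compat; apply H.
  - apply Rplus_le_le_0_compat; apply Cmod_ge_0.
Qed.

Lemma Zsummable_ext (f g : Z -> C) : (forall k, f k = g k) -> Zsummable f -> Zsummable g.
Proof.
  intros H; apply Zsummable_le; intros k; rewrite H; lra.
Qed.

Lemma Zsum_ext (f g : Z -> C) : (forall k, f k = g k) -> Zsum f = Zsum g.
Proof. intros H; apply Csum_ext; intros n; rewrite !H; reflexivity. Qed.

Lemma Zsummable_plus (f g : Z -> C) :
  Zsummable f -> Zsummable g -> Zsummable (fun k => f k + g k).
Proof.
  rewrite !Zsummable_half; intros [A B] [C D]; split;
    apply abs_summable_plus; assumption.
Qed.

Lemma Zsummable_scal (c : C) (f : Z -> C) :
  Zsummable f -> Zsummable (fun k => c * f k).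
Proof.
  rewrite !Zsummable_half; intros [A B]; split; apply abs_summable_scal; assumption.
Qed.

Lemma Zsum_plus (f g : Z -> C) :
  Zsummable f -> Zsummable g -> Zsum (fun k => f k + g k) = Zsum f + Zsum g.
Proof.
  intros Hf Hg; unfold Zsum.
  rewrite <- Csum_plus by (apply Zsummable_fold; assumption).
  apply Csum_ext; intros n; ring.
Qed.

Lemma Zsum_scal (c : C) (f : Z -> C) :
  Zsummable f -> Zsum (fun k => c * f k) = c * Zsum f.
Proof.
  intros Hf; unfold Zsum; rewrite <- Csum_scal by (apply Zsummable_fold; assumption).
  apply Csum_ext; intros n; ring.
Qed.

Lemma Cmod_Zsum_le (f : Z -> C) (g : Z -> R) :
  (forall k, Cmod (f k) <= g k)%R -> Zsummable_R g -> (Cmod (Zsum f) <= ZsumR g)%R.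
Proof.
  intros H Hg; assert (Hf := Zsummable_le _ _ H Hg).
  eapply Rle_trans; [apply Cmod_Csum_le, Zsummable_fold, Hf|].
  apply Series_le; [|exact Hg]. intros n; split; [apply Cmod_ge_0|].
  eapply Rle_trans; [apply Cmod_triangle|]. apply Rplus_le_compat; apply H.
Qed.

Lemma term_le_Series (a : nat -> R) (n : nat) :
  (forall k, 0 <= a k)%R -> ex_series a -> (a n <= Series a)%R.
Proof.
  revert a; induction n as [|n IH]; intros a Ha Hs; rewrite (Series_incr_1 _ Hs).
  - assert (0 <= Series (fun k => a (S k)))%R; [|lra].
    apply Series_ge_0; [intros k; apply Ha|].
    apply ex_series_incr_1 in Hs; exact Hs.
  - generalize (Ha 0%nat) (IH (fun k => a (S k)) (fun k => Ha (S k)) (proj1 (ex_series_incr_1 a) Hs)).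
    lra.
Qed.

Lemma Z_fold_cases (k : Z) : exists n : nat, k = Z.of_nat n \/ k = (- Z.of_nat n - 1)%Z.
Proof.
  destruct (Z_le_gt_dec 0 k).
  - exists (Z.to_nat k); left; lia.
  - exists (Z.to_nat (- k - 1)); right; lia.
Qed.

Lemma term_le_ZsumR (g : Z -> R) (k : Z) :
  (forall k, 0 <= g k)%R -> Zsummable_R g -> (g k <= ZsumR g)%R.
Proof.
  intros P H; destruct (Z_fold_cases k) as [n Hn].
  apply Rle_trans with (Zfold Rplus g n).
  - unfold Zfold.
    generalize (P (Z.of_nat n)) (P (- Z.of_nat n - 1)%Z); intros.
    destruct Hn as [-> | ->]; lra.
  - apply term_le_Series; [|exact H]. intros j; apply Rplus_le_le_0_compat; apply P.
Qed.

Lemma Csum_incr_1 (a : nat -> C) :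
  abs_summable a -> Csum a = a O + Csum (fun n => a (S n)).
Proof.
  intros H; unfold Csum.
  rewrite (Series_incr_1 _ (ex_series_Re _ H)), (Series_incr_1 _ (ex_series_Im _ H)).
  destruct (a O); reflexivity.
Qed.

Lemma Zsummable_succ (f : Z -> C) : Zsummable f -> Zsummable (fun k => f (k + 1)%Z).
Proof.
  rewrite !Zsummable_half; intros [A B]; split; unfold abs_summable in *.
  - apply ex_series_incr_1 in A.
    apply ex_series_ext with (2 := A); intros n; do 2 f_equal; lia.
  - apply ex_series_incr_1.
    apply ex_series_ext with (2 := B); intros n; do 2 f_equal; lia.
Qed.

(** A shift does not permute the folded pairs. The boundary term [f 0] moves from the nonnegative
    half to the negative half, hence the separate convergence of both halves. *)
Lemma Zsum_succ (f : Z -> C) : Zsummable f -> Zsum (fun k => f (k + 1)%Z) = Zsum f.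
Proof.
  intros H; assert (H1 := Zsummable_succ _ H).
  rewrite !Zsum_half by assumption.
  apply Zsummable_half in H; apply Zsummable_half in H1.
  destruct H as [A _], H1 as [_ B].
  rewrite (Csum_incr_1 _ A), (Csum_incr_1 _ B).
  rewrite (Csum_ext (fun n => f (Z.of_nat (S n))) (fun n => f (Z.of_nat n + 1)%Z))
    by (intros n; f_equal; lia).
  rewrite (Csum_ext (fun n => f (- Z.of_nat (S n) - 1 + 1)%Z) (fun n => f (- Z.of_nat n - 1)%Z))
    by (intros n; f_equal; lia).
  change (- Z.of_nat 0 - 1 + 1)%Z with (Z.of_nat 0). ring.
Qed.

Lemma Zsummable_reflect (f : Z -> C) : Zsummable f -> Zsummable (fun k => f (- k)%Z).
Proof.
  intros H; apply Zsummable_half in H.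
  apply Zsummable_half; split; unfold abs_summable.
  - apply ex_series_incr_1. apply ex_series_ext with (2 := proj2 H); intros n; do 2 f_equal; lia.
  - destruct H as [H _]; unfold abs_summable in H; apply ex_series_incr_1 in H.
    apply ex_series_ext with (2 := H); intros n; do 2 f_equal; lia.
Qed.

(** After a shift by one, the reflection becomes [k -> - k - 1], which only swaps the two members of
    each folded pair. *)
Lemma Zsum_reflect (f : Z -> C) : Zsummable f -> Zsum (fun k => f (- k)%Z) = Zsum f.
Proof.
  intros H; rewrite <- (Zsum_succ (fun k => f (- k)%Z)) by (apply Zsummable_reflect; exact H).
  apply Csum_ext; intros n; rewrite Cplus_comm; f_equal; f_equal; lia.
Qed.

Lemma Zsum_shift (f : Z -> C) (j : Z) :
  Zsummable f -> Zsummable (fun k => f (k + j)%Z) /\ Zsum (fun k => f (k + j)%Z) = Zsum f.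
Proof.
  assert (Hn : forall (n : nat) (g : Z -> C), Zsummable g ->
    Zsummable (fun k => g (k + Z.of_nat n)%Z) /\ Zsum (fun k => g (k + Z.of_nat n)%Z) = Zsum g).
  { induction n as [|n IH]; intros g Hg.
    - split; [apply Zsummable_ext with (2 := Hg) | apply Zsum_ext];
        intros k; f_equal; lia.
    - destruct (IH _ (Zsummable_succ _ Hg)) as [I1 I2].
      rewrite <- (Zsum_succ g Hg), <- I2.
      split; [apply Zsummable_ext with (2 := I1) | apply Zsum_ext];
        intros k; f_equal; lia. }
  intros H; destruct (Z_le_gt_dec 0 j) as [Hj|Hj].
  - rewrite <- (Z2Nat.id j Hj); apply Hn; exact H.
  (* A negative shift is a nonnegative one conjugated by the reflection. *)
  - destruct (Hn (Z.to_nat (- j)) _ (Zsummable_reflect _ H)) as [I1 I2].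
    apply Zsummable_reflect in I1 as I3.
    rewrite <- (Zsum_reflect f H), <- I2, <- (Zsum_reflect _ I1).
    split; [apply Zsummable_ext with (2 := I3) | apply Zsum_ext];
        intros k; f_equal; lia.
Qed.

Lemma Csum_even_odd (a : nat -> C) :
  abs_summable (fun n => a (2 * n)%nat) -> abs_summable (fun n => a (2 * n + 1)%nat) ->
  abs_summable a /\ Csum a = Csum (fun n => a (2 * n)%nat) + Csum (fun n => a (2 * n + 1)%nat).
Proof.
  assert (HS : forall b : nat -> R, ex_series (fun n => b (2 * n)%nat) ->
    ex_series (fun n => b (2 * n + 1)%nat) ->
    is_series b (Series (fun n => b (2 * n)%nat) + Series (fun n => b (2 * n + 1)%nat))%R).
  (* A series is read as a power series at 1, so that the even and odd decomposition of power series
     applies. *)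
  { assert (PS : forall (b : nat -> R) l, is_pseries b 1 l <-> is_series b l).
    { intros b l; split; apply is_series_ext; intros n; rewrite pow_n_pow, pow1;
        [exact (Rmult_1_l _) | exact (eq_sym (Rmult_1_l _))]. }
    intros b He Ho.
    apply PS.
    replace (Series (fun n => b (2 * n + 1)%nat)) with (1 * Series (fun n => b (2 * n + 1)%nat))%R by ring.
    apply is_pseries_odd_even; rewrite pow1; apply PS; apply Series_correct; assumption. }
  intros He Ho; split.
  - eexists; apply HS; assumption.
  - unfold Csum; apply injective_projections; simpl;
      apply is_series_unique; apply HS;
      first [apply (ex_series_Re _ He) | apply (ex_series_Re _ Ho) |
             apply (ex_series_Im _ He) | apply (ex_series_Im _ Ho)].
Qed.

(** On the negative half the parities cross: position [n] carries the index [- n - 1], so even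
    positions feed the odd subsum. *)
Lemma Zsum_even_odd (f : Z -> C) :
  Zsummable (fun k => f (2 * k)%Z) -> Zsummable (fun k => f (2 * k + 1)%Z) ->
  Zsum f = Zsum (fun k => f (2 * k)%Z) + Zsum (fun k => f (2 * k + 1)%Z).
Proof.
  intros He Ho; rewrite (Zsum_half _ He), (Zsum_half _ Ho).
  apply Zsummable_half in He; apply Zsummable_half in Ho.
  destruct He as [E1 E2], Ho as [O1 O2].
  destruct (Csum_even_odd (fun n => f (Z.of_nat n))) as [S1 R1].
  { apply ex_series_ext with (2 := E1); intros n; do 2 f_equal; lia. }
  { apply ex_series_ext with (2 := O1); intros n; do 2 f_equal; lia. }
  destruct (Csum_even_odd (fun n => f (- Z.of_nat n - 1)%Z)) as [S2 R2].
  { apply ex_series_ext with (2 := O2); intros n; do 2 f_equal; lia. }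
  { apply ex_series_ext with (2 := E2); intros n; do 2 f_equal; lia. }
  rewrite Zsum_half by (apply Zsummable_half; split; assumption).
  rewrite R1, R2.
  rewrite (Csum_ext (fun n => f (Z.of_nat (2 * n))) (fun n => f (2 * Z.of_nat n)%Z))
    by (intros n; f_equal; lia).
  rewrite (Csum_ext (fun n => f (Z.of_nat (2 * n + 1))) (fun n => f (2 * Z.of_nat n + 1)%Z))
    by (intros n; f_equal; lia).
  rewrite (Csum_ext (fun n => f (- Z.of_nat (2 * n) - 1)%Z) (fun n => f (2 * (- Z.of_nat n - 1) + 1)%Z))
    by (intros n; f_equal; lia).
  rewrite (Csum_ext (fun n => f (- Z.of_nat (2 * n + 1) - 1)%Z) (fun n => f (2 * (- Z.of_nat n - 1))%Z))
    by (intros n; f_equal; lia).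
  ring.
Qed.

(** * Dominated convergence and exchange of summations *)

Lemma is_lim_seq_0_iff (u : nat -> R) :
  (forall n, 0 <= u n)%R ->
  is_lim_seq u 0 <-> (forall eps, 0 < eps -> exists N, forall n, (N <= n)%nat -> u n < eps)%R.
Proof.
  intros P; rewrite <- is_lim_seq_spec; split.
  - intros H eps He; destruct (H (mkposreal eps He)) as [N HN]; exists N; intros n Hn.
    specialize (HN n Hn); simpl in HN; rewrite Rminus_0_r, Rabs_pos_eq in HN; auto.
  - intros H [eps He]; destruct (H eps He) as [N HN]; exists N; intros n Hn; simpl.
    rewrite Rminus_0_r, Rabs_pos_eq; auto.
Qed.

Lemma Series_tail_lim (M : nat -> R) :
  ex_series M -> is_lim_seq (fun N => Series (fun k => M (S N + k)%nat)) 0.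
Proof.
  intros H.
  apply is_lim_seq_ext with (fun N => Series M - sum_n M N)%R.
  - intros N; rewrite (Series_incr_n M (S N)) by (lia || exact H).
    rewrite sum_n_Reals; simpl; ring.
  - replace (Finite 0) with (Finite (Series M - Series M)) by (f_equal; ring).
    apply is_lim_seq_minus'.
    + apply is_lim_seq_const.
    + exact (Series_correct _ H).
Qed.

(** The tail of [M] is small uniformly in [n]; the finitely many remaining terms tend to 0 one by
    one. *)
Lemma Series_dominated_0 (d : nat -> nat -> R) (M : nat -> R) :
  (forall n k, 0 <= d n k <= M k)%R -> ex_series M ->
  (forall k, is_lim_seq (fun n => d n k) 0) ->
  is_lim_seq (fun n => Series (d n)) 0.
Proof.
  intros B HM L.
  assert (Hd : forall n, ex_series (d n)).
  { intros n; apply ex_series_dom with (2 := HM); intros k; rewrite Rabs_pos_eq; apply B. }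
  apply is_lim_seq_0_iff.
  { intros n; apply Series_ge_0; [intros k; apply B | apply Hd]. }
  intros eps He.
  assert (P : forall n, (0 <= Series (fun k => M (S n + k)%nat))%R).
  { intros n; apply Series_ge_0.
    - intros k; generalize (B O (S n + k)%nat); lra.
    - apply (ex_series_incr_n M (S n)); exact HM. }
  destruct (proj1 (is_lim_seq_0_iff _ P) (Series_tail_lim _ HM) (eps / 2)%R) as [N HN]; [lra|].
  assert (LS : is_lim_seq (fun n => sum_f_R0 (d n) N) 0).
  { clear HN; induction N as [|N IH]; simpl; [apply L|].
    replace (Finite 0) with (Finite (0 + 0)) by (f_equal; ring).
    apply is_lim_seq_plus'; [exact IH | apply L]. }
  assert (PS : forall n, (0 <= sum_f_R0 (d n) N)%R).
  { intros n; apply cond_pos_sum; intros k; apply B. }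
  destruct (proj1 (is_lim_seq_0_iff _ PS) LS (eps / 2)%R) as [N' HN']; [lra|].
  exists N'; intros n Hn.
  rewrite (Series_incr_n (d n) (S N)) by (lia || apply Hd); simpl pred.
  specialize (HN N (le_n _)); specialize (HN' n Hn).
  assert (Series (fun k => d n (S N + k)%nat) <= Series (fun k => M (S N + k)%nat))%R; [|lra].
  apply Series_le; [intros k; apply B|].
  apply (ex_series_incr_n M (S N)); exact HM.
Qed.

(** Stated through a real null sequence, so that squeezing and dominated convergence remain
    statements about real series. *)
Definition Ccv (u : nat -> C) (l : C) := is_lim_seq (fun n => Cmod (u n - l)) 0.

Lemma Ccv_ext (u v : nat -> C) (l : C) : (forall n, u n = v n) -> Ccv u l -> Ccv v l.
Proof. intros H; apply is_lim_seq_ext; intros n; rewrite H; reflexivity. Qed.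

Lemma Ccv_const (l : C) : Ccv (fun _ => l) l.
Proof.
  unfold Ccv; apply is_lim_seq_ext with (fun _ => 0%R); [|apply is_lim_seq_const].
  intros _; replace (l - l) with (RtoC 0) by ring; rewrite Cmod_0; reflexivity.
Qed.

Lemma Ccv_dominated (u : nat -> C) (l : C) (d : nat -> R) :
  (forall n, Cmod (u n - l) <= d n)%R -> is_lim_seq d 0 -> Ccv u l.
Proof.
  intros H; apply is_lim_seq_le_le with (u := fun _ => 0%R); [|apply is_lim_seq_const].
  intros n; split; [apply Cmod_ge_0 | apply H].
Qed.

Lemma Ccv_Cmod (u : nat -> C) (l : C) : Ccv u l -> is_lim_seq (fun n => Cmod (u n)) (Cmod l).
Proof.
  intros H; unfold Ccv in H.
  apply is_lim_seq_le_le with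
    (u := fun n => (Cmod l - Cmod (u n - l))%R) (w := fun n => (Cmod l + Cmod (u n - l))%R).
  - intros n; split.
    + generalize (Cmod_triangle (u n) (- (u n - l))); rewrite Cmod_opp.
      replace (u n + - (u n - l)) with l by ring; lra.
    + generalize (Cmod_triangle l (u n - l)).
      replace (l + (u n - l)) with (u n) by ring; lra.
  - replace (Finite (Cmod l)) with (Finite (Cmod l - 0)) by (f_equal; ring).
    apply is_lim_seq_minus'; [apply is_lim_seq_const | exact H].
  - replace (Finite (Cmod l)) with (Finite (Cmod l + 0)) by (f_equal; ring).
    apply is_lim_seq_plus'; [apply is_lim_seq_const | exact H].
Qed.

Lemma Ccv_mult (u v : nat -> C) (l m : C) :
  Ccv u l -> Ccv v m -> Ccv (fun n => u n * v n) (l * m).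
Proof.
  intros Hu Hv; apply Ccv_dominated with
    (fun n => Cmod (u n) * Cmod (v n - m) + Cmod (u n - l) * Cmod m)%R.
  - intros n; replace (u n * v n - l * m) with (u n * (v n - m) + (u n - l) * m) by ring.
    rewrite <- !Cmod_mult; apply Cmod_triangle.
  - replace (Finite 0) with (Finite (Cmod l * 0 + 0 * Cmod m)) by (f_equal; ring).
    apply is_lim_seq_plus'; apply is_lim_seq_mult'; try assumption.
    + apply Ccv_Cmod; assumption.
    + apply is_lim_seq_const.
Qed.

Lemma Ccv_Re (u : nat -> C) (l : C) : Ccv u l -> is_lim_seq (fun n => Re (u n)) (Re l).
Proof.
  intros H; apply is_lim_seq_spec; intros eps.
  destruct (proj1 (is_lim_seq_0_iff _ (fun n => Cmod_ge_0 _)) H eps (cond_pos eps)) as [N HN].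
  exists N; intros n Hn; eapply Rle_lt_trans; [|exact (HN n Hn)].
  exact (re_le_Cmod (u n - l)).
Qed.

Lemma Ccv_Im (u : nat -> C) (l : C) : Ccv u l -> is_lim_seq (fun n => Im (u n)) (Im l).
Proof.
  intros H; apply is_lim_seq_spec; intros eps.
  destruct (proj1 (is_lim_seq_0_iff _ (fun n => Cmod_ge_0 _)) H eps (cond_pos eps)) as [N HN].
  exists N; intros n Hn; eapply Rle_lt_trans; [|exact (HN n Hn)].
  exact (im_le_Cmod (u n - l)).
Qed.

Lemma Ccv_unique (u : nat -> C) (l m : C) : Ccv u l -> Ccv u m -> l = m.
Proof.
  intros Hl Hm; apply injective_projections.
  - assert (E := is_lim_seq_unique _ _ (Ccv_Re _ _ Hl)).
    rewrite (is_lim_seq_unique _ _ (Ccv_Re _ _ Hm)) in E; injection E; auto.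
  - assert (E := is_lim_seq_unique _ _ (Ccv_Im _ _ Hl)).
    rewrite (is_lim_seq_unique _ _ (Ccv_Im _ _ Hm)) in E; injection E; auto.
Qed.

Lemma Zsum_dominated (u : nat -> Z -> C) (L : Z -> C) (M : Z -> R) :
  (forall n k, Cmod (u n k) <= M k)%R -> Zsummable_R M ->
  (forall k, Ccv (fun n => u n k) (L k)) ->
  Ccv (fun n => Zsum (u n)) (Zsum L).
Proof.
  intros B HM HL.
  assert (BL : forall k, (Cmod (L k) <= M k)%R).
  { intros k.
    assert (H := is_lim_seq_le (fun n => Cmod (u n k)) (fun _ => M k) (Cmod (L k)) (M k)
      (fun n => B n k) (Ccv_Cmod _ _ (HL k)) (is_lim_seq_const _)).
    exact H. }
  assert (SL := Zsummable_le _ _ BL HM).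
  assert (SU := fun n => Zsummable_le _ _ (B n) HM).
  assert (Bd : forall n k, (Cmod (u n k - L k) <= 2 * M k)%R).
  { intros n k; unfold Cminus; eapply Rle_trans; [apply Cmod_triangle|].
    rewrite Cmod_opp; generalize (B n k) (BL k); lra. }
  assert (HM2 : Zsummable_R (fun k => 2 * M k)%R).
  { apply ex_series_ext with (fun n => 2 * Zfold Rplus M n)%R.
    - intros n; unfold Zfold; simpl; ring.
    - apply (ex_series_scal_l (V := R_NormedModule)); exact HM. }
  apply Ccv_dominated with (fun n => ZsumR (fun k => Cmod (u n k - L k))).
  - intros n.
    replace (Zsum (u n) - Zsum L) with (Zsum (fun k => u n k - L k)).
    + apply Cmod_Zsum_le; [intros k; lra|].
      apply (Zsummable_le _ _ (Bd n) HM2).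
    + rewrite (Zsum_ext (fun k => u n k - L k) (fun k => u n k + (-1) * L k)) by (intros; ring).
      rewrite Zsum_plus, Zsum_scal; auto using Zsummable_scal. ring.
  - apply Series_dominated_0 with (2 := HM2).
    + intros n k; unfold Zfold; split.
      * apply Rplus_le_le_0_compat; apply Cmod_ge_0.
      * apply Rplus_le_compat; apply Bd.
    + intros k; unfold Zfold; replace (Finite 0) with (Finite (0 + 0)) by (f_equal; ring).
      apply is_lim_seq_plus'; apply HL.
Qed.

Fixpoint Cpsum (a : nat -> C) (N : nat) : C :=
  match N with O => a O | S n => Cpsum a n + a (S n) end.

Lemma Re_Cpsum (a : nat -> C) N : Re (Cpsum a N) = sum_n (fun n => Re (a n)) N.
Proof.
  induction N as [|N IH]; simpl.
  - rewrite sum_O; reflexivity.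
  - rewrite sum_Sn, <- IH; reflexivity.
Qed.

Lemma Im_Cpsum (a : nat -> C) N : Im (Cpsum a N) = sum_n (fun n => Im (a n)) N.
Proof.
  induction N as [|N IH]; simpl.
  - rewrite sum_O; reflexivity.
  - rewrite sum_Sn, <- IH; reflexivity.
Qed.

Lemma Csum_unique (a : nat -> C) (l : C) : Ccv (Cpsum a) l -> Csum a = l.
Proof.
  intros H; unfold Csum; apply injective_projections; simpl; apply is_series_unique.
  - apply (is_lim_seq_ext (fun N => Re (Cpsum a N)) (sum_n (fun n => Re (a n))) (Re l)).
    + intros N; apply Re_Cpsum.
    + apply Ccv_Re, H.
  - apply (is_lim_seq_ext (fun N => Im (Cpsum a N)) (sum_n (fun n => Im (a n))) (Im l)).
    + intros N; apply Im_Cpsum.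
    + apply Ccv_Im, H.
Qed.

Lemma Csum_cv (a : nat -> C) : abs_summable a -> Ccv (Cpsum a) (Csum a).
Proof.
  intros H.
  apply Ccv_dominated with
    (fun N => Rabs (Re (Cpsum a N) - Re (Csum a)) + Rabs (Im (Cpsum a N) - Im (Csum a)))%R.
  - intros N; generalize (Cpsum a N) (Csum a); intros [x y] [x' y']; simpl.
    replace ((x, y) - (x', y')) with (RtoC (x - x') + Ci * RtoC (y - y'))
      by (apply injective_projections; simpl; ring).
    eapply Rle_trans; [apply Cmod_triangle|].
    rewrite Cmod_mult, !Cmod_R.
    rewrite Cmod_Ci.
    lra.
  - replace (Finite 0) with (Finite (0 + 0)) by (f_equal; ring).
    apply is_lim_seq_plus'.
    + rewrite <- Rabs_R0; apply (is_lim_seq_abs _ (Finite 0)).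
      replace (Finite 0) with (Finite (Re (Csum a) - Re (Csum a))) by (f_equal; ring).
      apply is_lim_seq_minus'; [|apply is_lim_seq_const].
      apply (is_lim_seq_ext (sum_n (fun n => Re (a n)))); [intros N; symmetry; apply Re_Cpsum|].
      exact (Series_correct _ (ex_series_Re _ H)).
    + rewrite <- Rabs_R0; apply (is_lim_seq_abs _ (Finite 0)).
      replace (Finite 0) with (Finite (Im (Csum a) - Im (Csum a))) by (f_equal; ring).
      apply is_lim_seq_minus'; [|apply is_lim_seq_const].
      apply (is_lim_seq_ext (sum_n (fun n => Im (a n)))); [intros N; symmetry; apply Im_Cpsum|].
      exact (Series_correct _ (ex_series_Im _ H)).
Qed.

Lemma Cmod_Cpsum_le (a : nat -> C) (b : nat -> R) (N : nat) :
  (forall n, Cmod (a n) <= b n)%R -> ex_series b -> (Cmod (Cpsum a N) <= Series b)%R.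
Proof.
  intros H Hb.
  assert (P : forall n, (0 <= b n)%R)
    by (intros n; eapply Rle_trans; [apply Cmod_ge_0|apply H]).
  apply Rle_trans with (sum_f_R0 b N).
  - induction N as [|N IH]; simpl; [apply H|].
    eapply Rle_trans; [apply Cmod_triangle|]. apply Rplus_le_compat; auto.
  - rewrite (Series_incr_n b (S N)) by (lia || exact Hb); simpl pred.
    assert (0 <= Series (fun k => b (S N + k)%nat))%R; [|lra].
    apply Series_ge_0; [intros; apply P|]. apply (ex_series_incr_n b (S N)); exact Hb.
Qed.

(* Partial sums in the inner index are dominated by the row sums, so dominated
   convergence exchanges the limit with the outer sum. *)
Lemma Zsum_exchange_cv (f : Z -> Z -> C) (F : Z -> R) :
  (forall k, Zsummable (f k)) ->
  (forall k, ZsumR (fun l => Cmod (f k l)) <= F k)%R -> Zsummable_R F ->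
  (forall l, Zsummable (fun k => f k l)) /\
  Ccv (Cpsum (Zfold Cplus (fun l => Zsum (fun k => f k l)))) (Zsum (fun k => Zsum (f k))).
Proof.
  intros Hr HF SF.
  assert (Hc : forall l, Zsummable (fun k => f k l)).
  { intros l; apply Zsummable_le with (2 := SF); intros k.
    apply Rle_trans with (2 := HF k).
    apply (term_le_ZsumR (fun l => Cmod (f k l))); [intros; apply Cmod_ge_0 | apply Hr]. }
  split; [exact Hc|].
  set (g := fun k n => f k (Z.of_nat n) + f k (- Z.of_nat n - 1)%Z).
  apply Ccv_ext with (fun N => Zsum (fun k => Cpsum (g k) N)).
  - assert (Hg : forall n, Zsummable (fun k => g k n))
      by (intros n; apply Zsummable_plus; apply Hc).
    intros N.
    assert (H : Zsummable (fun k => Cpsum (g k) N) /\ Zsum (fun k => Cpsum (g k) N) =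
      Cpsum (fun n => Zsum (fun k => f k (Z.of_nat n)) + Zsum (fun k => f k (- Z.of_nat n - 1)%Z)) N).
    { induction N as [|N [I1 I2]]; simpl; split; auto.
      - apply Zsum_plus; apply Hc.
      - apply Zsummable_plus; auto.
      - rewrite Zsum_plus, I2 by auto; f_equal; apply Zsum_plus; apply Hc. }
    apply H.
  - apply Zsum_dominated with (2 := SF).
    + intros n k; apply Rle_trans with (2 := HF k).
      apply Cmod_Cpsum_le; [intros; apply Cmod_triangle | apply Hr].
    + intros k; apply Csum_cv, Zsummable_fold, Hr.
Qed.

Lemma Zsum_exchange (f : Z -> Z -> C) (F : Z -> R) :
  (forall k, Zsummable (f k)) ->
  (forall k, ZsumR (fun l => Cmod (f k l)) <= F k)%R -> Zsummable_R F ->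
  Zsummable (fun l => Zsum (fun k => f k l)) /\
  Zsum (fun k => Zsum (f k)) = Zsum (fun l => Zsum (fun k => f k l)).
Proof.
  intros Hr HF SF; destruct (Zsum_exchange_cv f F Hr HF SF) as [Hc Hcv]; split.
  - assert (E : forall k l, Cmod (RtoC (Cmod (f k l))) = Cmod (f k l))
      by (intros; rewrite Cmod_R, Rabs_pos_eq; [reflexivity | apply Cmod_ge_0]).
    (* Convergence for [f] alone says nothing about absolute convergence of the column sums. Applied
       to the absolute values, the same statement yields a summable majorant for them. *)
    destruct (Zsum_exchange_cv (fun k l => RtoC (Cmod (f k l))) F) as [_ Ha].
    + intros k; apply Zsummable_le with (2 := Hr k); intros l; rewrite E; lra.
    + intros k; apply Rle_trans with (2 := HF k); right; apply Series_ext; intros n;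
        unfold Zfold; rewrite !E; reflexivity.
    + exact SF.
    + apply Ccv_Re in Ha.
      apply Zsummable_le with (fun l => Re (Zsum (fun k => RtoC (Cmod (f k l))))).
      * intros l; change (Cmod (Zsum (fun k => f k l)) <= ZsumR (fun k => Cmod (f k l)))%R.
        apply Cmod_Zsum_le; [intros k; lra | apply Hc].
      * eexists.
        apply (is_lim_seq_ext _ _ _ (Re_Cpsum _)) in Ha; exact Ha.
  - symmetry; apply Csum_unique; exact Hcv.
Qed.

Lemma ZsumR_scal (c : R) (g : Z -> R) :
  Zsummable_R g ->
  Zsummable_R (fun k => c * g k)%R /\ ZsumR (fun k => c * g k)%R = (c * ZsumR g)%R.
Proof.
  intros H.
  assert (E : forall n, (Zfold Rplus (fun k => c * g k) n = c * Zfold Rplus g n)%R)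
    by (intros n; unfold Zfold; ring).
  split.
  - apply ex_series_ext with (fun n => c * Zfold Rplus g n)%R; [intros n; symmetry; apply E|].
    apply (ex_series_scal_l (V := R_NormedModule)); exact H.
  - unfold ZsumR; rewrite <- Series_scal_l; apply Series_ext, E.
Qed.

Lemma Zsummable_mult (u v : Z -> C) :
  Zsummable u -> Zsummable v -> Zsummable (fun k => u k * v k).
Proof.
  intros Hu Hv.
  apply Zsummable_le with (2 := proj1 (ZsumR_scal (ZsumR (fun k => Cmod (u k))) _ Hv)).
  intros k; rewrite Cmod_mult; apply Rmult_le_compat_r; [apply Cmod_ge_0|].
  apply (term_le_ZsumR (fun k => Cmod (u k))); [intros; apply Cmod_ge_0 | exact Hu].
Qed.

(** For fixed [l] the inner sum is a shift of the sum of [u], so the double sum factors. The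
    exchange is licensed because each row of absolute values sums to the same constant times
    [|v l|]. *)
Lemma Zsum_mult_diagonals (u v : Z -> C) :
  Zsummable u -> Zsummable v ->
  Zsummable (fun d => Zsum (fun l => u (l + d)%Z * v l)) /\
  Zsum u * Zsum v = Zsum (fun d => Zsum (fun l => u (l + d)%Z * v l)).
Proof.
  intros Hu Hv.
  replace (Zsum u * Zsum v) with (Zsum (fun l => Zsum (fun d => u (l + d)%Z * v l))).
  - assert (Hs : forall l, Zsummable (fun d => u (l + d)%Z)).
    { intros l; apply Zsummable_ext with (2 := proj1 (Zsum_shift u l Hu)).
      intros k; f_equal; lia. }
    assert (EU : forall l, ZsumR (fun d => Cmod (u (l + d)%Z)) = ZsumR (fun k => Cmod (u k))).
    { intros l.
      (* The shift lemma concerns complex sums: absolute values are embedded in [C] and the first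
         component is read off. *)
      assert (Ha : Zsummable (fun k => RtoC (Cmod (u k)))).
      { apply Zsummable_le with (2 := Hu); intros k; rewrite Cmod_R, Rabs_pos_eq; [lra|apply Cmod_ge_0]. }
      assert (E := f_equal fst (proj2 (Zsum_shift _ l Ha))); simpl in E.
      unfold ZsumR, Zfold; rewrite <- E; apply Series_ext; intros n.
      do 3 f_equal; lia. }
    set (A := ZsumR (fun k => Cmod (u k))).
    apply Zsum_exchange with (fun l => A * Cmod (v l))%R.
    + intros l; apply Zsummable_ext with (fun d => v l * u (l + d)%Z); [intros; ring|].
      apply Zsummable_scal, Hs.
    + intros l; right.
      transitivity (ZsumR (fun d => Cmod (v l) * Cmod (u (l + d)%Z))%R).
      * apply Series_ext; intros n; unfold Zfold; rewrite !Cmod_mult; ring.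
      * rewrite (proj2 (ZsumR_scal _ _ (Hs l))), EU; unfold A; ring.
    + apply (ZsumR_scal A _ Hv).
  - rewrite (Zsum_ext (fun l => Zsum (fun d => u (l + d)%Z * v l)) (fun l => Zsum u * v l)).
    + rewrite Zsum_scal by exact Hv; ring.
    + intros l.
      destruct (Zsum_shift u l Hu) as [S E].
      rewrite <- E, Cmult_comm, <- Zsum_scal by exact S.
      apply Zsum_ext; intros d; rewrite Z.add_comm, Cmult_comm; reflexivity.
Qed.

(** * Theta series and their termwise derivatives *)

Lemma exp_le_mono (x y : R) : (x <= y)%R -> (exp x <= exp y)%R.
Proof.
  intros [H | ->]; [left; apply exp_increasing; exact H | right; reflexivity].
Qed.

Lemma gaussian_summable (c B al : R) :
  (0 < c)%R ->
  Zsummable_R (fun k => exp (- c * ((IZR k + al) * (IZR k + al)) + B * Rabs (IZR k + al)))%R.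
Proof.
  intros Hc.
  (* Completing the square in [- c q^2 + (B + 1) q] gives the quotient. The extra 1 leaves a factor
     [exp (- q)], and [Rabs al] pays for passing from [q = |k + al|] to [|k|]. *)
  set (K := ((B + 1) * (B + 1) / (4 * c) + Rabs al)%R).
  assert (Hk : forall k : Z,
    (exp (- c * ((IZR k + al) * (IZR k + al)) + B * Rabs (IZR k + al)) <= exp (K - Rabs (IZR k)))%R).
  { intros k; apply exp_le_mono; unfold K.
    set (q := Rabs (IZR k + al)).
    replace ((IZR k + al) * (IZR k + al))%R with (q * q)%R
      by (unfold q; rewrite <- Rabs_mult; apply Rabs_pos_eq, Rle_0_sqr).
    assert (Hq : (Rabs (IZR k) <= q + Rabs al)%R).
    { unfold q; replace (IZR k) with ((IZR k + al) + - al)%R at 1 by ring.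
      rewrite <- (Rabs_Ropp al); apply Rabs_triang. }
    assert (Hs : (- c * (q * q) + (B + 1) * q <= (B + 1) * (B + 1) / (4 * c))%R).
    { apply Rmult_le_reg_r with (4 * c)%R; [lra|].
      replace ((B + 1) * (B + 1) / (4 * c) * (4 * c))%R with ((B + 1) * (B + 1))%R by (field; lra).
      assert (0 <= (2 * c * q - (B + 1)) * (2 * c * q - (B + 1)))%R by exact (Rle_0_sqr _). lra. }
    lra. }
  (* Both members of a folded pair have absolute value at least [n], hence the factor 2. *)
  apply ex_series_dom with (fun n => (2 * exp K) * exp (- 1) ^ n)%R.
  - intros n; unfold Zfold; rewrite Rabs_pos_eq.
    2: { apply Rplus_le_le_0_compat; left; apply exp_pos. }
    assert (E : (exp (-1) ^ n = exp (- INR n))%R).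
    { induction n as [|n IH]; [simpl; rewrite Ropp_0, exp_0; reflexivity|].
      rewrite S_INR; simpl; rewrite IH, <- exp_plus; f_equal; ring. }
    assert (P := pos_INR n).
    rewrite E, Rmult_assoc, <- exp_plus.
    generalize (Hk (Z.of_nat n)) (Hk (- Z.of_nat n - 1)%Z).
    rewrite minus_IZR, opp_IZR, <- INR_IZR_INZ.
    rewrite (Rabs_pos_eq (INR n)) by lra.
    rewrite (Rabs_left (- INR n - 1)) by lra.
    assert (exp (K - - (- INR n - 1)) <= exp (K + - INR n))%R by (apply exp_le_mono; lra).
    intros h1 h2; change (exp (K - INR n)) with (exp (K + - INR n)) in h1; lra.
  - apply (ex_series_scal_l (V := R_NormedModule)), ex_series_geom.
    rewrite Rabs_pos_eq by (left; apply exp_pos).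
    rewrite <- exp_0; apply exp_increasing; lra.
Qed.

Definition gterm (q : R) (w tau : C) : C :=
  cexp (RtoC PI * Ci * RtoC q * RtoC q * tau + 2 * RtoC PI * Ci * RtoC q * w).

(** The logarithmic derivative of [gterm q] in [w]. Its exponential is also the multiplier under
    [w -> w + 1]. *)
Definition freq (q : R) : C := 2 * RtoC PI * Ci * RtoC q.

(* [Theta (a/2) (z + b/2)] is the theta function with characteristic [(a, b)];
   [dTheta] is its termwise derivative. *)
Definition Theta (al : R) (w tau : C) : C := Zsum (fun k => gterm (IZR k + al) w tau).
Definition dTheta (al : R) (w tau : C) : C :=
  Zsum (fun k => freq (IZR k + al) * gterm (IZR k + al) w tau).

Lemma Cmod_freq (q : R) : Cmod (freq q) = (2 * PI * Rabs q)%R.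
Proof.
  unfold freq; rewrite !Cmod_mult, !Cmod_R.
  rewrite Cmod_Ci.
  rewrite (Rabs_pos_eq PI) by (generalize PI_RGT_0; lra).
  rewrite (Rabs_pos_eq 2) by lra. ring.
Qed.

Lemma Cmod_gterm (q : R) (w tau : C) :
  (Cmod (gterm q w tau) <=
   exp (- (PI * Im tau) * (q * q) + 2 * PI * Rabs (Im w) * Rabs q))%R.
Proof.
  unfold gterm; rewrite Cmod_cexp; apply exp_le_mono.
  destruct w as [x y], tau as [s t]; simpl.
  assert (H : (- (q * y) <= Rabs y * Rabs q)%R).
  { rewrite <- Rabs_mult, (Rmult_comm y), <- Rabs_Ropp; apply Rle_abs. }
  assert (P := PI_RGT_0).
  apply (Rmult_le_compat_l (2 * PI)) in H; [|lra]. ring_simplify. lra.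
Qed.

(** The slope [B] is left free so that polynomial factors in [q], coming from [freq] and from Taylor
    remainders, are absorbed by enlarging it. *)
Definition gmaj (B y al : R) (k : Z) : R :=
  exp (- (PI * y) * ((IZR k + al) * (IZR k + al)) + B * Rabs (IZR k + al)).

Lemma gmaj_summable (B y al : R) : (0 < y)%R -> Zsummable_R (gmaj B y al).
Proof.
  intros H; apply gaussian_summable, Rmult_lt_0_compat; [apply PI_RGT_0 | exact H].
Qed.

Lemma gterm_summable (al : R) (w tau : C) :
  (0 < Im tau)%R -> Zsummable (fun k => gterm (IZR k + al) w tau).
Proof.
  intros H; apply Zsummable_le with (2 := gmaj_summable (2 * PI * Rabs (Im w)) (Im tau) al H).
  intros k; apply Cmod_gterm.
Qed.

Lemma freq_gterm_summable (al : R) (w tau : C) :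
  (0 < Im tau)%R -> Zsummable (fun k => freq (IZR k + al) * gterm (IZR k + al) w tau).
Proof.
  intros H; assert (S := gmaj_summable (2 * PI * Rabs (Im w) + 1) (Im tau) al H).
  apply Zsummable_le with (2 := proj1 (ZsumR_scal (2 * PI) _ S)).
  intros k; unfold gmaj; set (q := (IZR k + al)%R).
  rewrite Cmod_mult, Cmod_freq, Rmult_assoc.
  apply Rmult_le_compat_l; [generalize PI_RGT_0; lra|].
  rewrite Rmult_plus_distr_r, <- Rplus_assoc, exp_plus, Rmult_1_l, Rmult_comm.
  apply Rmult_le_compat; auto using Cmod_ge_0, Rabs_pos, Cmod_gterm, Rabs_le_exp.
Qed.

Lemma is_derive_C_quadratic (f : C -> C) (w l : C) (K : R) :
  (forall h, Cmod h <= 1 -> Cmod (f (w + h)%C - f w - h * l) <= K * (Cmod h * Cmod h))%R ->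
  @is_derive C_AbsRing C_NormedModule f w l.
Proof.
  intros H; split.
  { apply (is_linear_scal_l (K := C_AbsRing) (V := C_NormedModule)). }
  intros x Hx.
  assert (E : w = x) by (apply (is_filter_lim_locally_unique (K := C_AbsRing) (V := AbsRing_NormedModule C_AbsRing)); exact Hx).
  subst x; intros eps.
  (* Nothing fixes the sign of [K], and the radius below divides by a positive number. *)
  set (K' := (Rabs K + 1)%R).
  assert (PK : (0 < K')%R) by (unfold K'; generalize (Rabs_pos K); lra).
  assert (Pd : (0 < Rmin 1 (eps / K'))%R).
  { apply Rmin_pos; [lra|]. apply Rdiv_lt_0_compat; [apply cond_pos | exact PK]. }
  exists (mkposreal _ Pd); intros y Hy; change C in y.
  change (Cmod (y - w) < Rmin 1 (eps / K'))%R in Hy.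
  change (Cmod (f y - f w - (y - w) * l) <= eps * Cmod (y - w))%R.
  assert (H1 : (Cmod (y - w) <= 1)%R) by (generalize (Rmin_l 1 (eps / K')); lra).
  assert (H2 : (Cmod (y - w) * K' <= eps)%R).
  { replace (pos eps) with (eps / K' * K')%R by (field; lra).
    apply Rmult_le_compat_r; [lra|]. generalize (Rmin_r 1 (eps / K')); lra. }
  specialize (H (y - w) H1); replace (w + (y - w)) with y in H by ring.
  eapply Rle_trans; [exact H|].
  assert (P := Cmod_ge_0 (y - w)). rewrite <- Rmult_assoc.
  apply Rmult_le_compat_r; [exact P|].
  apply Rle_trans with (2 := H2). rewrite Rmult_comm; apply Rmult_le_compat_l; [exact P|].
  unfold K'; generalize (Rle_abs K); lra.
Qed.

Lemma Theta_taylor (al : R) (w tau : C) :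
  (0 < Im tau)%R ->
  exists K, forall h, (Cmod h <= 1)%R ->
  (Cmod (Theta al (w + h) tau - Theta al w tau - h * dTheta al w tau) <= K * (Cmod h * Cmod h))%R.
Proof.
  intros H.
  (* Beyond the growth of [gterm], [2 * PI] covers [exp |freq q * h|] with [|h| <= 1], and 2 covers
     [q^2 <= exp (2 |q|)]. In [c] below, 5 is the constant of [cexp_remainder] and [4 * PI * PI]
     comes from [|freq q|^2]. *)
  set (B := (2 * PI * Rabs (Im w) + (2 * PI + 2))%R).
  assert (S := gmaj_summable B (Im tau) al H).
  set (c := (5 * (4 * PI * PI))%R).
  exists (c * ZsumR (gmaj B (Im tau) al))%R.
  intros h Hh; unfold Theta, dTheta.
  assert (E : forall k, gterm (IZR k + al) (w + h) tau
                 + ((-1) * gterm (IZR k + al) w tau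
                    + (- h) * (freq (IZR k + al) * gterm (IZR k + al) w tau))
               = gterm (IZR k + al) w tau *
                 (cexp (freq (IZR k + al) * h) - 1 - freq (IZR k + al) * h)).
  { intros k.
    replace (gterm (IZR k + al) (w + h) tau)
      with (gterm (IZR k + al) w tau * cexp (freq (IZR k + al) * h)); [ring|].
    unfold gterm; rewrite <- cexp_plus; f_equal; unfold freq; ring. }
  assert (G := fun v => gterm_summable al v tau H).
  assert (F := freq_gterm_summable al w tau H).
  match goal with |- (Cmod ?X <= _)%R => replace X with
    (Zsum (fun k => gterm (IZR k + al) w tau *
                 (cexp (freq (IZR k + al) * h) - 1 - freq (IZR k + al) * h))) end.
  2: { rewrite <- (Zsum_ext _ _ E), !Zsum_plus, !Zsum_scal; auto using Zsummable_plus, Zsummable_scal.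
       ring. }
  destruct (ZsumR_scal (c * (Cmod h * Cmod h))%R _ S) as [S' E'].
  replace (c * ZsumR (gmaj B (Im tau) al) * (Cmod h * Cmod h))%R
    with (c * (Cmod h * Cmod h) * ZsumR (gmaj B (Im tau) al))%R by ring.
  rewrite <- E'; apply Cmod_Zsum_le; [|exact S'].
  intros k; rewrite Cmod_mult; set (q := (IZR k + al)%R).
  assert (Ph := Cmod_ge_0 h). assert (Pq := Rabs_pos q). assert (PP := PI_RGT_0).
  assert (R := cexp_remainder (freq q * h)).
  rewrite Cmod_mult, Cmod_freq in R.
  assert (Hq := Rabs_le_exp q).
  assert (X : (exp (2 * PI * Rabs q * Cmod h) <= exp (2 * PI * Rabs q))%R).
  { apply exp_le_mono. rewrite <- (Rmult_1_r (2 * PI * Rabs q)) at 2.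
    apply Rmult_le_compat_l; [|exact Hh]. apply Rmult_le_pos; lra. }
  assert (Y : (Rabs q * Rabs q <= exp (2 * Rabs q))%R).
  { replace (2 * Rabs q)%R with (Rabs q + Rabs q)%R by ring; rewrite exp_plus.
    apply Rmult_le_compat; assumption. }
  assert (Z : (Cmod (cexp (freq q * h) - 1 - freq q * h) <=
    c * (Cmod h * Cmod h) * exp ((2 * PI + 2) * Rabs q))%R).
  { eapply Rle_trans; [exact R|].
    replace ((2 * PI + 2) * Rabs q)%R with (2 * Rabs q + 2 * PI * Rabs q)%R by ring.
    rewrite exp_plus.
    replace (5 * (2 * PI * Rabs q * Cmod h * (2 * PI * Rabs q * Cmod h)))%R
      with (c * (Cmod h * Cmod h) * (Rabs q * Rabs q))%R by (unfold c; ring).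
    rewrite (Rmult_assoc (c * (Cmod h * Cmod h))).
    apply Rmult_le_compat_l.
    { apply Rmult_le_pos; [unfold c; nra | apply Rmult_le_pos; exact Ph]. }
    apply Rmult_le_compat; try assumption; [nra | left; apply exp_pos]. }
  unfold gmaj; fold q; unfold B; rewrite Rmult_plus_distr_r, <- Rplus_assoc, exp_plus.
  rewrite (Rmult_comm (Cmod (gterm _ _ _))).
  replace (c * (Cmod h * Cmod h) * (exp (- (PI * Im tau) * (q * q) + 2 * PI * Rabs (Im w) * Rabs q) *
   exp ((2 * PI + 2) * Rabs q)))%R with
   ((c * (Cmod h * Cmod h) * exp ((2 * PI + 2) * Rabs q)) *
    exp (- (PI * Im tau) * (q * q) + 2 * PI * Rabs (Im w) * Rabs q))%R by ring.
  apply Rmult_le_compat; auto using Cmod_ge_0, Cmod_gterm.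
Qed.

Lemma Cderiv_unique (f : C -> C) (z l : C) :
  @is_derive C_AbsRing C_NormedModule f z l -> Cderiv f z = l.
Proof.
  intros H.
  assert (E : @is_derive C_AbsRing C_NormedModule f z (Cderiv f z))
    by exact (epsilon_spec (inhabits (RtoC 0)) _ (ex_intro _ l H)).
  apply is_C_derive_unique in H; apply is_C_derive_unique in E; congruence.
Qed.

Lemma theta_Theta (a b : Z) (z tau : C) :
  theta a b z tau = Theta (IZR a / 2) (z + RtoC (IZR b / 2)) tau.
Proof. reflexivity. Qed.

Lemma theta'_dTheta (a b : Z) (z tau : C) :
  (0 < Im tau)%R -> theta' a b z tau = dTheta (IZR a / 2) (z + RtoC (IZR b / 2)) tau.
Proof.
  intros H; apply Cderiv_unique.
  destruct (Theta_taylor (IZR a / 2) (z + RtoC (IZR b / 2)) tau H) as [K HK].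
  apply is_derive_C_quadratic with K; intros h Hh; rewrite !theta_Theta.
  replace (z + h + RtoC (IZR b / 2)) with (z + RtoC (IZR b / 2) + h) by ring.
  apply HK, Hh.
Qed.

Lemma theta1'_dTheta (z tau : C) :
  (0 < Im tau)%R -> theta1' z tau = - dTheta (1 / 2) (z + RtoC (1 / 2)) tau.
Proof.
  intros H; apply Cderiv_unique.
  destruct (Theta_taylor (1 / 2) (z + RtoC (1 / 2)) tau H) as [K HK].
  apply is_derive_C_quadratic with K; intros h Hh; unfold theta1; rewrite !theta_Theta.
  specialize (HK h Hh); rewrite <- Cmod_opp in HK.
  match type of HK with (Cmod ?X <= _)%R => match goal with |- (Cmod ?Y <= _)%R =>
    replace Y with X; [exact HK|] end end.
  replace (z + h + RtoC (1 / 2)) with (z + RtoC (1 / 2) + h) by ring.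
  ring.
Qed.

(** * Product formulas *)

Lemma Theta_char_shift (al : R) (j : Z) (w tau : C) :
  (0 < Im tau)%R -> Theta (al + IZR j) w tau = Theta al w tau.
Proof.
  intros H; unfold Theta.
  rewrite <- (proj2 (Zsum_shift _ j (gterm_summable al w tau H))).
  apply Zsum_ext; intros k; f_equal; rewrite plus_IZR; ring.
Qed.

Lemma dTheta_char_shift (al : R) (j : Z) (w tau : C) :
  (0 < Im tau)%R -> dTheta (al + IZR j) w tau = dTheta al w tau.
Proof.
  intros H; unfold dTheta.
  rewrite <- (proj2 (Zsum_shift _ j (freq_gterm_summable al w tau H))).
  apply Zsum_ext; intros k; rewrite plus_IZR.
  replace (IZR k + (al + IZR j))%R with (IZR k + IZR j + al)%R by ring; reflexivity.
Qed.

Lemma gterm_opp (q : R) (w tau : C) : gterm (- q) (- w) tau = gterm q w tau.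
Proof. unfold gterm; f_equal; rewrite RtoC_opp; ring. Qed.

Lemma Theta_opp (al : R) (w tau : C) : (0 < Im tau)%R -> Theta (- al) (- w) tau = Theta al w tau.
Proof.
  intros H; unfold Theta; rewrite <- (Zsum_reflect _ (gterm_summable al w tau H)).
  apply Zsum_ext; intros k; rewrite <- gterm_opp; f_equal; [rewrite opp_IZR; ring | ring].
Qed.

Lemma dTheta_opp (al : R) (w tau : C) : (0 < Im tau)%R -> dTheta (- al) (- w) tau = - dTheta al w tau.
Proof.
  intros H; assert (S := freq_gterm_summable al w tau H).
  unfold dTheta; rewrite <- (Zsum_reflect _ S).
  replace (- Zsum (fun k => freq (IZR (- k) + al) * gterm (IZR (- k) + al) w tau))
    with (-1 * Zsum (fun k => freq (IZR (- k) + al) * gterm (IZR (- k) + al) w tau)) by ring.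
  rewrite <- Zsum_scal by exact (Zsummable_reflect _ S).
  apply Zsum_ext; intros k; rewrite <- (gterm_opp (IZR (- k) + al)).
  replace (IZR k + - al)%R with (- (IZR (- k) + al))%R by (rewrite opp_IZR; ring).
  unfold freq; rewrite RtoC_opp; ring.
Qed.

Lemma gterm_period (al : R) (k : Z) (w tau : C) :
  gterm (IZR k + al) (w + 1) tau = cexp (freq al) * gterm (IZR k + al) w tau.
Proof.
  assert (E : cexp (RtoC PI * Ci * RtoC (IZR (2 * k))) = 1).
  { rewrite cexp_Zhalf; unfold sgnZ; rewrite Z.even_mul; reflexivity. }
  transitivity (cexp (RtoC PI * Ci * RtoC (IZR (2 * k))) * cexp (freq al) * gterm (IZR k + al) w tau);
    [|rewrite E; ring].
  unfold gterm, freq; rewrite <- !cexp_plus; f_equal.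
  rewrite mult_IZR, RtoC_mult, RtoC_plus; ring.
Qed.

Lemma Theta_period (al : R) (w tau : C) :
  (0 < Im tau)%R -> Theta al (w + 1) tau = cexp (freq al) * Theta al w tau.
Proof.
  intros H; unfold Theta; rewrite <- Zsum_scal by (apply gterm_summable; exact H).
  apply Zsum_ext; intros k; apply gterm_period.
Qed.

Lemma dTheta_period (al : R) (w tau : C) :
  (0 < Im tau)%R -> dTheta al (w + 1) tau = cexp (freq al) * dTheta al w tau.
Proof.
  intros H; unfold dTheta; rewrite <- Zsum_scal by (apply freq_gterm_summable; exact H).
  apply Zsum_ext; intros k; rewrite gterm_period; ring.
Qed.

(** The form [p^2 + q^2] equals twice the sum of the squares of [(p - q) / 2] and [(p + q) / 2],
    which doubles [tau]; the linear part [p x + q y] splits likewise. *)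
Lemma gterm_mult (p q : R) (x y tau : C) :
  gterm p x tau * gterm q y tau =
  gterm ((p - q) / 2) (x - y) (2 * tau) * gterm ((p + q) / 2) (x + y) (2 * tau).
Proof.
  unfold gterm; rewrite <- !cexp_plus; f_equal.
  destruct x, y, tau; apply injective_projections; simpl; field.
Qed.

Lemma Im_double_pos (tau : C) : (0 < Im tau)%R -> (0 < Im (2 * tau))%R.
Proof. destruct tau; simpl; lra. Qed.

Lemma Zsum_fixed_difference (al be : R) (d : Z) (x y tau : C) :
  (0 < Im tau)%R ->
  Zsum (fun l => gterm (IZR (l + d) + al) x tau * gterm (IZR l + be) y tau) =
  gterm ((IZR d + (al - be)) / 2) (x - y) (2 * tau) *
  Theta ((al + be + IZR d) / 2) (x + y) (2 * tau).
Proof.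
  intros H; unfold Theta.
  rewrite <- Zsum_scal by (apply gterm_summable, Im_double_pos, H).
  apply Zsum_ext; intros l; rewrite gterm_mult; f_equal; f_equal; rewrite plus_IZR; field.
Qed.

(* The sum over the difference [d] of the two summation indices is split by
   the parity of [d], on which the characteristic of the inner sum depends. *)
Lemma parity_split (W : R -> C) (al be : R) (x y tau : C) :
  (0 < Im tau)%R ->
  (forall ga, Zsummable (fun k => W (IZR k + ga)%R * gterm (IZR k + ga) (x - y) (2 * tau))) ->
  Zsum (fun d => W ((IZR d + (al - be)) / 2)%R *
     Zsum (fun l => gterm (IZR (l + d) + al) x tau * gterm (IZR l + be) y tau)) =
  Zsum (fun k => W (IZR k + (al - be) / 2)%R * gterm (IZR k + (al - be) / 2) (x - y) (2 * tau))
    * Theta ((al + be) / 2) (x + y) (2 * tau) +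
  Zsum (fun k => W (IZR k + (al - be + 1) / 2)%R * gterm (IZR k + (al - be + 1) / 2) (x - y) (2 * tau))
    * Theta ((al + be + 1) / 2) (x + y) (2 * tau).
Proof.
  intros H HW; assert (H2 := Im_double_pos tau H).
  assert (Ee : forall k : Z, W ((IZR (2 * k) + (al - be)) / 2)%R *
     Zsum (fun l => gterm (IZR (l + 2 * k) + al) x tau * gterm (IZR l + be) y tau) =
     Theta ((al + be) / 2) (x + y) (2 * tau) *
     (W (IZR k + (al - be) / 2)%R * gterm (IZR k + (al - be) / 2) (x - y) (2 * tau))).
  { intros k; rewrite (Zsum_fixed_difference al be (2 * k)%Z) by exact H.
    rewrite (mult_IZR 2).
    replace ((2 * IZR k + (al - be)) / 2)%R with (IZR k + (al - be) / 2)%R by field.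
    replace ((al + be + 2 * IZR k) / 2)%R with ((al + be) / 2 + IZR k)%R by field.
    rewrite Theta_char_shift by exact H2; ring. }
  assert (Eo : forall k : Z, W ((IZR (2 * k + 1) + (al - be)) / 2)%R *
     Zsum (fun l => gterm (IZR (l + (2 * k + 1)) + al) x tau * gterm (IZR l + be) y tau) =
     Theta ((al + be + 1) / 2) (x + y) (2 * tau) *
     (W (IZR k + (al - be + 1) / 2)%R * gterm (IZR k + (al - be + 1) / 2) (x - y) (2 * tau))).
  { intros k; rewrite (Zsum_fixed_difference al be (2 * k + 1)%Z) by exact H.
    rewrite plus_IZR, (mult_IZR 2).
    replace ((2 * IZR k + 1 + (al - be)) / 2)%R with (IZR k + (al - be + 1) / 2)%R by field.
    replace ((al + be + (2 * IZR k + 1)) / 2)%R with ((al + be + 1) / 2 + IZR k)%R by field.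
    rewrite Theta_char_shift by exact H2; ring. }
  rewrite Zsum_even_odd.
  - rewrite (Zsum_ext _ _ Ee), (Zsum_ext _ _ Eo), !Zsum_scal by apply HW; ring.
  - eapply Zsummable_ext; [intros k; symmetry; apply Ee|]. apply Zsummable_scal, HW.
  - eapply Zsummable_ext; [intros k; symmetry; apply Eo|]. apply Zsummable_scal, HW.
Qed.

Lemma Theta_mult (al be : R) (x y tau : C) :
  (0 < Im tau)%R ->
  Theta al x tau * Theta be y tau =
  Theta ((al - be) / 2) (x - y) (2 * tau) * Theta ((al + be) / 2) (x + y) (2 * tau) +
  Theta ((al - be + 1) / 2) (x - y) (2 * tau) * Theta ((al + be + 1) / 2) (x + y) (2 * tau).
Proof.
  intros H; assert (H2 := Im_double_pos tau H).
  unfold Theta at 1 2.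
  rewrite (proj2 (Zsum_mult_diagonals _ _ (gterm_summable al x tau H) (gterm_summable be y tau H))).
  assert (E := parity_split (fun _ => 1) al be x y tau H).
  assert (E1 : forall ga, Zsum (fun k => 1 * gterm (IZR k + ga) (x - y) (2 * tau)) = Theta ga (x - y) (2 * tau))
    by (intros ga; apply Zsum_ext; intros k; ring).
  rewrite !E1 in E; rewrite <- E.
  - apply Zsum_ext; intros d; ring.
  - intros ga; apply Zsummable_scal, gterm_summable, H2.
Qed.

(** Differentiation brings down [freq p - freq q = 2 freq ((p - q) / 2)], which is constant on each
    diagonal. The parity splitting therefore applies with this weight in place of 1. *)
Lemma Theta_wronskian (al be : R) (x y tau : C) :
  (0 < Im tau)%R ->
  dTheta al x tau * Theta be y tau - Theta al x tau * dTheta be y tau =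
  2 * (dTheta ((al - be) / 2) (x - y) (2 * tau) * Theta ((al + be) / 2) (x + y) (2 * tau) +
  dTheta ((al - be + 1) / 2) (x - y) (2 * tau) * Theta ((al + be + 1) / 2) (x + y) (2 * tau)).
Proof.
  intros H; assert (H2 := Im_double_pos tau H).
  assert (G1 := gterm_summable al x tau H). assert (G2 := gterm_summable be y tau H).
  assert (F1 := freq_gterm_summable al x tau H). assert (F2 := freq_gterm_summable be y tau H).
  set (u := fun k => gterm (IZR k + al) x tau) in *.
  set (v := fun k => gterm (IZR k + be) y tau) in *.
  set (fu := fun k => freq (IZR k + al) * gterm (IZR k + al) x tau) in *.
  set (fv := fun k => freq (IZR k + be) * gterm (IZR k + be) y tau) in *.
  destruct (Zsum_mult_diagonals fu v F1 G2) as [S1 E1]. destruct (Zsum_mult_diagonals u fv G1 F2) as [S2 E2].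
  change (Theta al x tau) with (Zsum u); change (Theta be y tau) with (Zsum v).
  change (dTheta al x tau) with (Zsum fu); change (dTheta be y tau) with (Zsum fv).
  assert (P := parity_split (fun q => 2 * freq q) al be x y tau H).
  assert (ED : forall ga, Zsum (fun k => 2 * freq (IZR k + ga) * gterm (IZR k + ga) (x - y) (2 * tau))
     = 2 * dTheta ga (x - y) (2 * tau)).
  { intros ga; unfold dTheta; rewrite <- Zsum_scal by (apply freq_gterm_summable, H2).
    apply Zsum_ext; intros k; ring. }
  cbv beta in P; rewrite !ED in P.
  transitivity (2 * dTheta ((al - be) / 2) (x - y) (2 * tau) * Theta ((al + be) / 2) (x + y) (2 * tau) +
  2 * dTheta ((al - be + 1) / 2) (x - y) (2 * tau) * Theta ((al + be + 1) / 2) (x + y) (2 * tau)); [|ring].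
  rewrite <- P.
  2: { intros ga; eapply Zsummable_ext; [intros k; apply Cmult_assoc|].
       apply Zsummable_scal, freq_gterm_summable, H2. }
  rewrite E1, E2.
  transitivity (Zsum (fun d => Zsum (fun l => fu (l + d)%Z * v l) +
                               -1 * Zsum (fun l => u (l + d)%Z * fv l))).
  { rewrite Zsum_plus, Zsum_scal; auto using Zsummable_scal; ring. }
  apply Zsum_ext; intros d.
  destruct (Zsum_shift u d G1) as [Sd _].
  assert (M1 := Zsummable_mult _ _ Sd G2). assert (M2 := Zsummable_mult _ _ Sd F2).
  rewrite (Zsum_ext (fun l => fu (l + d)%Z * v l)
    (fun l => u (l + d)%Z * fv l + 2 * freq ((IZR d + (al - be)) / 2) * (u (l + d)%Z * v l))).
  - rewrite Zsum_plus, Zsum_scal; auto using Zsummable_scal.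
    change (Zsum (fun l => u (l + d)%Z * v l)) with
      (Zsum (fun l => gterm (IZR (l + d) + al) x tau * gterm (IZR l + be) y tau)).
    ring.
  - intros l; unfold fu, fv, u, v.
    replace (freq (IZR (l + d) + al)) with (freq (IZR l + be) + 2 * freq ((IZR d + (al - be)) / 2)).
    + ring.
    + unfold freq; rewrite plus_IZR; apply injective_projections; simpl; field.
Qed.

(** * Jacobi's derivative formula *)

Definition half : C := RtoC (1 / 2).

Lemma half_half : half + half = 1.
Proof. unfold half; apply injective_projections; simpl; field. Qed.

Lemma cexp_freq_half : cexp (freq (1 / 2)) = -1.
Proof.
  rewrite <- cexp_half; f_equal; unfold freq; apply injective_projections; simpl; field.
Qed.

Lemma cexp_freq_quarter : cexp (freq (1 / 4)) = Ci.
Proof.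
  rewrite <- cexp_quarter; f_equal; unfold freq; apply injective_projections; simpl; field.
Qed.

Lemma cexp_freq_0 : cexp (freq 0) = 1.
Proof.
  rewrite <- cexp_0; f_equal; unfold freq; apply injective_projections; simpl; ring.
Qed.

Lemma Ci_sqr : Ci * Ci = -1.
Proof. apply injective_projections; simpl; ring. Qed.

Lemma cexp_freq_three_quarters : cexp (freq (3 / 4)) = - Ci.
Proof.
  replace (freq (3 / 4)) with (freq (1 / 2) + freq (1 / 4)).
  - rewrite cexp_plus, cexp_freq_half, cexp_freq_quarter; ring.
  - unfold freq; apply injective_projections; simpl; field.
Qed.

Lemma C_double_0 (x : C) : x = - x -> x = 0.
Proof.
  intros H; assert (E : 2 * x = 0) by (replace (2 * x) with (x + x) by ring; rewrite H at 1; ring).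
  destruct x as [a b]; apply (f_equal fst) in E as E1; apply (f_equal snd) in E as E2.
  simpl in E1, E2; apply injective_projections; simpl; lra.
Qed.

(** Up to sign this is [theta1] at zero: reflection preserves the value, while moving [- half] to
    [half] by the period 1 changes its sign. *)
Lemma Theta_half_half (tau : C) : (0 < Im tau)%R -> Theta (1 / 2) half tau = 0.
Proof.
  intros H; apply C_double_0.
  transitivity (Theta (- (1 / 2) + IZR 1) (- half) tau).
  - rewrite Theta_char_shift, Theta_opp by exact H; reflexivity.
  - replace (- (1 / 2) + IZR 1)%R with (1 / 2)%R by (simpl; field).
    replace half with (- half + 1) at 2 by (rewrite <- half_half; ring).
    rewrite Theta_period, cexp_freq_half by exact H; ring.
Qed.

Lemma Theta_0_opp_half (tau : C) : (0 < Im tau)%R -> Theta 0 (- half) tau = Theta 0 half tau.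
Proof.
  intros H; rewrite <- (Theta_opp 0 half) by exact H; rewrite Ropp_0; reflexivity.
Qed.

Lemma dTheta_0_half (tau : C) : (0 < Im tau)%R -> dTheta 0 half tau = 0.
Proof.
  intros H; apply C_double_0.
  rewrite <- (dTheta_opp 0 half) by exact H; rewrite Ropp_0.
  replace half with (- half + 1) at 1 by (rewrite <- half_half; ring).
  rewrite dTheta_period, cexp_freq_0 by exact H; ring.
Qed.

(** The odd diagonals carry [theta1] at zero and drop out, leaving [theta4 (2 z | 2 tau)] as the
    only function of [z]. *)
Lemma theta34 (z tau : C) : (0 < Im tau)%R ->
  Theta 0 z tau * Theta 0 (z + half) tau = Theta 0 half (2 * tau) * Theta 0 (2 * z + half) (2 * tau).
Proof.
  intros H; assert (H2 := Im_double_pos tau H); rewrite Theta_mult by exact H.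
  replace (z - (z + half)) with (- half) by ring.
  replace (z + (z + half)) with (2 * z + half) by ring.
  replace ((0 - 0) / 2)%R with 0%R by field.
  replace ((0 + 0) / 2)%R with 0%R by field.
  replace ((0 - 0 + 1) / 2)%R with (- (1 / 2) + IZR 1)%R by (simpl; field).
  rewrite Theta_char_shift, Theta_opp, Theta_half_half, Theta_0_opp_half by exact H2; ring.
Qed.

(** Here the even diagonals drop out, since they carry the derivative of [theta4] at zero. The
    surviving function of [z] is the one in [theta34]. *)
Lemma wronskian12 (z tau : C) : (0 < Im tau)%R ->
  dTheta (1 / 2) (z + half) tau * Theta (1 / 2) z tau - Theta (1 / 2) (z + half) tau * dTheta (1 / 2) z tau
  = 2 * (dTheta (1 / 2) half (2 * tau) * Theta 0 (2 * z + half) (2 * tau)).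
Proof.
  intros H; assert (H2 := Im_double_pos tau H); rewrite Theta_wronskian by exact H.
  replace (z + half - z) with half by ring.
  replace (z + half + z) with (2 * z + half) by ring.
  replace ((1 / 2 - 1 / 2) / 2)%R with 0%R by field.
  replace ((1 / 2 - 1 / 2 + 1) / 2)%R with (1 / 2)%R by field.
  replace ((1 / 2 + 1 / 2 + 1) / 2)%R with (0 + IZR 1)%R by (simpl; field).
  rewrite Theta_char_shift, dTheta_0_half by exact H2; ring.
Qed.

(** The two parity terms coincide, hence the factor 2. With [theta34] at zero this gives the
    doubling rules for the theta constants. *)
Lemma theta22 (tau : C) : (0 < Im tau)%R ->
  Theta (1 / 2) 0 tau * Theta (1 / 2) 0 tau = 2 * (Theta (1 / 2) 0 (2 * tau) * Theta 0 0 (2 * tau)).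
Proof.
  intros H; assert (H2 := Im_double_pos tau H); rewrite Theta_mult by exact H.
  replace (0 - 0) with (RtoC 0) by ring.
  replace (0 + 0) with (RtoC 0) by ring.
  replace ((1 / 2 - 1 / 2) / 2)%R with 0%R by field.
  replace ((1 / 2 - 1 / 2 + 1) / 2)%R with (1 / 2)%R by field.
  replace ((1 / 2 + 1 / 2) / 2)%R with (1 / 2)%R by field.
  replace ((1 / 2 + 1 / 2 + 1) / 2)%R with (0 + IZR 1)%R by (simpl; field).
  rewrite Theta_char_shift by exact H2; ring.
Qed.

(** Since [3/4 = 1 - 1/4], reflection exchanges the two quarter characteristics; this lets the two
    parity terms share one constant below. *)
Lemma Theta_three_quarters (w tau : C) : (0 < Im tau)%R -> Theta (3 / 4) (- w) tau = Theta (1 / 4) w tau.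
Proof.
  intros H; rewrite <- (Theta_opp (1 / 4) w) by exact H.
  rewrite <- (Theta_char_shift (- (1 / 4)) 1) by exact H.
  f_equal; simpl; field.
Qed.

Lemma dTheta_three_quarters (w tau : C) : (0 < Im tau)%R -> dTheta (3 / 4) (- w) tau = - dTheta (1 / 4) w tau.
Proof.
  intros H; rewrite <- dTheta_opp by exact H.
  rewrite <- (dTheta_char_shift (- (1 / 4)) 1) by exact H.
  f_equal; simpl; field.
Qed.

Lemma theta23 (z tau : C) : (0 < Im tau)%R ->
  Theta (1 / 2) z tau * Theta 0 z tau =
  Theta (1 / 4) 0 (2 * tau) * (Theta (1 / 4) (2 * z) (2 * tau) + Theta (3 / 4) (2 * z) (2 * tau)).
Proof.
  intros H; assert (H2 := Im_double_pos tau H); rewrite Theta_mult by exact H.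
  replace (z - z) with (- RtoC 0) by ring.
  replace (z + z) with (2 * z) by ring.
  replace ((1 / 2 - 0) / 2)%R with (1 / 4)%R by field.
  replace ((1 / 2 + 0) / 2)%R with (1 / 4)%R by field.
  replace ((1 / 2 - 0 + 1) / 2)%R with (3 / 4)%R by field.
  replace ((1 / 2 + 0 + 1) / 2)%R with (3 / 4)%R by field.
  rewrite Theta_three_quarters by exact H2.
  replace (- RtoC 0) with (RtoC 0) by ring; ring.
Qed.

(** The argument gains a full period, giving the phases [i] and [- i]. The sign of the reflected
    derivative compensates their difference, so the same sum as in [theta23] appears. *)
Lemma wronskian14 (z tau : C) : (0 < Im tau)%R ->
  dTheta (1 / 2) (z + half) tau * Theta 0 (z + half) tau - Theta (1 / 2) (z + half) tau * dTheta 0 (z + half) tau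
  = 2 * Ci * dTheta (1 / 4) 0 (2 * tau) *
    (Theta (1 / 4) (2 * z) (2 * tau) + Theta (3 / 4) (2 * z) (2 * tau)).
Proof.
  intros H; assert (H2 := Im_double_pos tau H); rewrite Theta_wronskian by exact H.
  replace (z + half - (z + half)) with (- RtoC 0) by ring.
  replace (z + half + (z + half)) with (2 * z + 1) by (rewrite <- half_half; ring).
  replace ((1 / 2 - 0) / 2)%R with (1 / 4)%R by field.
  replace ((1 / 2 + 0) / 2)%R with (1 / 4)%R by field.
  replace ((1 / 2 - 0 + 1) / 2)%R with (3 / 4)%R by field.
  replace ((1 / 2 + 0 + 1) / 2)%R with (3 / 4)%R by field.
  rewrite dTheta_three_quarters, !Theta_period, cexp_freq_quarter, cexp_freq_three_quarters by exact H2.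
  replace (- RtoC 0) with (RtoC 0) by ring; ring.
Qed.

Lemma theta24 (z tau : C) : (0 < Im tau)%R ->
  Theta (1 / 2) z tau * Theta 0 (z + half) tau =
  Theta (1 / 4) (- half) (2 * tau) *
  (Theta (1 / 4) (2 * z + half) (2 * tau) + Ci * Theta (3 / 4) (2 * z + half) (2 * tau)).
Proof.
  intros H; assert (H2 := Im_double_pos tau H); rewrite Theta_mult by exact H.
  replace (z - (z + half)) with (- half) by ring.
  replace (z + (z + half)) with (2 * z + half) by ring.
  replace ((1 / 2 - 0) / 2)%R with (1 / 4)%R by field.
  replace ((1 / 2 + 0) / 2)%R with (1 / 4)%R by field.
  replace ((1 / 2 - 0 + 1) / 2)%R with (3 / 4)%R by field.
  replace ((1 / 2 + 0 + 1) / 2)%R with (3 / 4)%R by field.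
  rewrite Theta_three_quarters by exact H2.
  replace (Theta (1 / 4) half (2 * tau)) with (Ci * Theta (1 / 4) (- half) (2 * tau)); [ring|].
  rewrite <- cexp_freq_quarter, <- Theta_period by exact H2; f_equal; rewrite <- half_half; ring.
Qed.

(** Reflection followed by a period gives the [3/4] derivative as [i] times the [1/4] one, the phase
    that also links the constants in [theta24]. *)
Lemma wronskian13 (z tau : C) : (0 < Im tau)%R ->
  dTheta (1 / 2) (z + half) tau * Theta 0 z tau - Theta (1 / 2) (z + half) tau * dTheta 0 z tau
  = 2 * dTheta (1 / 4) half (2 * tau) *
    (Theta (1 / 4) (2 * z + half) (2 * tau) + Ci * Theta (3 / 4) (2 * z + half) (2 * tau)).
Proof.
  intros H; assert (H2 := Im_double_pos tau H); rewrite Theta_wronskian by exact H.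
  replace (z + half - z) with half by ring.
  replace (z + half + z) with (2 * z + half) by ring.
  replace ((1 / 2 - 0) / 2)%R with (1 / 4)%R by field.
  replace ((1 / 2 + 0) / 2)%R with (1 / 4)%R by field.
  replace ((1 / 2 - 0 + 1) / 2)%R with (3 / 4)%R by field.
  replace ((1 / 2 + 0 + 1) / 2)%R with (3 / 4)%R by field.
  replace (dTheta (3 / 4) half (2 * tau)) with (Ci * dTheta (1 / 4) half (2 * tau)); [ring|].
  replace (dTheta (3 / 4) half (2 * tau)) with (- dTheta (1 / 4) (- half) (2 * tau)).
  - replace (dTheta (1 / 4) half (2 * tau)) with (Ci * dTheta (1 / 4) (- half) (2 * tau)).
    + rewrite Cmult_assoc, Ci_sqr; ring.
    + rewrite <- cexp_freq_quarter, <- dTheta_period by exact H2; f_equal; rewrite <- half_half; ring.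
  - rewrite <- dTheta_three_quarters by exact H2; f_equal; ring.
Qed.

(** * Limits at the cusp and their consequences *)

Lemma exp_double_cv_0 (a : R) : (0 < a)%R -> is_lim_seq (fun n => exp (- (a * 2 ^ n))) 0.
Proof.
  intros Ha.
  apply is_lim_seq_le_le with (u := fun _ => 0%R) (w := fun n => (/ a * (/ 2) ^ n)%R).
  - intros n; assert (P : (0 < a * 2 ^ n)%R) by (apply Rmult_lt_0_compat; [exact Ha | apply pow_lt; lra]).
    split; [left; apply exp_pos|].
    rewrite pow_inv, <- Rinv_mult, exp_Ropp.
    apply Rinv_le_contravar; [exact P|]. generalize (exp_ineq1_le (a * 2 ^ n)); lra.
  - apply is_lim_seq_const.
  - replace (Finite 0) with (Finite (/ a * 0)) by (f_equal; ring).
    apply is_lim_seq_mult'; [apply is_lim_seq_const|].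
    apply is_lim_seq_geom; rewrite Rabs_pos_eq; lra.
Qed.

(* As [tau] runs to the cusp along [2 ^ n * tau], only the terms whose exponent
   vanishes survive. *)
Lemma cusp_limit (c : Z -> C) (s : Z -> Z) (tau : C) :
  (0 < Im tau)%R -> (forall k, 0 <= s k)%Z ->
  (forall k, s k = 0 -> k = 0 \/ k = -1)%Z ->
  Zsummable (fun k => c k * cexp (RtoC PI * Ci * RtoC (IZR (s k)) * tau)) ->
  Ccv (fun n => Zsum (fun k => c k * cexp (RtoC PI * Ci * RtoC (IZR (s k)) * (RtoC (2 ^ n) * tau))))
      ((if (s 0 =? 0)%Z then c 0%Z else 0) + (if (s (-1) =? 0)%Z then c (-1)%Z else 0)).
Proof.
  intros Ht Hs Hz Sc.
  set (L := fun k : Z => if (s k =? 0)%Z then c k else 0).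
  assert (EL : Zsum L = L 0%Z + L (-1)%Z).
  (* The indices 0 and -1 form the first folded pair, so every partial sum already has the final
     value. *)
  { apply Csum_unique, Ccv_ext with (fun _ => L 0%Z + L (-1)%Z); [|apply Ccv_const].
    intros N; induction N as [|N IH]; [reflexivity|].
    change (L 0%Z + L (-1)%Z = Cpsum (fun n => L (Z.of_nat n) + L (- Z.of_nat n - 1)%Z) N
      + (L (Z.of_nat (S N)) + L (- Z.of_nat (S N) - 1)%Z)).
    rewrite <- IH.
    assert (L0 : forall k, (k <> 0)%Z -> (k <> -1)%Z -> L k = 0).
    { intros k h0 h1; unfold L; destruct (Z.eqb_spec (s k) 0) as [e|e]; [|reflexivity].
      destruct (Hz k e); contradiction. }
    rewrite (L0 (Z.of_nat (S N))), (L0 (- Z.of_nat (S N) - 1)%Z) by lia; ring. }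
  fold (L 0%Z); fold (L (-1)%Z); rewrite <- EL.
  assert (M : forall n k, Cmod (cexp (RtoC PI * Ci * RtoC (IZR (s k)) * (RtoC (2 ^ n) * tau))) =
     exp (- (PI * IZR (s k) * Im tau * 2 ^ n))).
  { intros n k; rewrite Cmod_cexp; f_equal; destruct tau; simpl; ring. }
  assert (P := PI_RGT_0).
  apply Zsum_dominated with (2 := Sc).
  - intros n k; rewrite !Cmod_mult; apply Rmult_le_compat_l; [apply Cmod_ge_0|].
    generalize (M 0%nat k); simpl pow; replace (RtoC 1 * tau) with tau by ring; intros ->.
    rewrite M; apply exp_le_mono.
    (* Exponents are nonnegative and only grow under doubling, so the terms at [tau] itself dominate
       the whole sequence. *)
    assert (1 <= 2 ^ n)%R by (apply pow_R1_Rle; lra).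
    assert (0 <= PI * IZR (s k) * Im tau)%R.
    { apply Rmult_le_pos; [apply Rmult_le_pos|]; try lra. apply IZR_le, Hs. }
    nra.
  - intros k; unfold L; destruct (Z.eqb_spec (s k) 0) as [e|e].
    + rewrite e; apply Ccv_ext with (fun _ => c k); [|apply Ccv_const].
      intros n; replace (RtoC PI * Ci * RtoC 0 * (RtoC (2 ^ n) * tau)) with (RtoC 0) by ring.
      rewrite cexp_0; ring.
    + apply Ccv_dominated with (fun n => Cmod (c k) * exp (- (PI * IZR (s k) * Im tau * 2 ^ n)))%R.
      * intros n; rewrite <- (M n k), <- Cmod_mult; right; f_equal; ring.
      * replace (Finite 0) with (Finite (Cmod (c k) * 0)) by (f_equal; ring).
        apply is_lim_seq_mult'; [apply is_lim_seq_const|].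
        apply exp_double_cv_0, Rmult_lt_0_compat; [apply Rmult_lt_0_compat|]; try assumption.
        apply IZR_lt; specialize (Hs k); lia.
Qed.

Definition dil (n : nat) (tau : C) : C := RtoC (2 ^ n) * tau.

Lemma Im_dil_pos (n : nat) (tau : C) : (0 < Im tau)%R -> (0 < Im (dil n tau))%R.
Proof.
  intros H; unfold dil; destruct tau as [x y]; simpl in *.
  assert (0 < 2 ^ n)%R by (apply pow_lt; lra).
  rewrite Rmult_0_l, Rplus_0_r; apply Rmult_lt_0_compat; assumption.
Qed.

Lemma dil_S (n : nat) (tau : C) : dil (S n) tau = dil n (2 * tau).
Proof. unfold dil; simpl; rewrite RtoC_mult; ring. Qed.

Lemma dil_0 (tau : C) : dil 0 tau = tau.
Proof. unfold dil; simpl; ring. Qed.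

Lemma theta0_cusp (w tau : C) : (0 < Im tau)%R -> Ccv (fun n => Theta 0 w (dil n tau)) 1.
Proof.
  intros H.
  assert (E : forall t k, gterm (IZR k + 0) w t =
    cexp (freq (IZR k) * w) * cexp (RtoC PI * Ci * RtoC (IZR (k * k)) * t)).
  { intros t k; unfold gterm, freq; rewrite <- cexp_plus; f_equal.
    rewrite Rplus_0_r, mult_IZR, RtoC_mult; ring. }
  assert (L := cusp_limit (fun k => cexp (freq (IZR k) * w)) (fun k => (k * k)%Z) tau H).
  cbv beta in L; simpl Z.eqb in L; cbv iota in L.
  replace (cexp (freq 0 * w) + 0) with (RtoC 1) in L.
  - eapply Ccv_ext; [|apply L]; try (intros; nia).
    + intros n; apply Zsum_ext; intros k; symmetry; apply E.
    + eapply Zsummable_ext; [|apply (gterm_summable 0 w tau H)]. intros k; apply E.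
  - replace (freq 0 * w) with (RtoC 0) by (unfold freq; ring). rewrite cexp_0; ring.
Qed.

(* Removes the leading term [exp (pi i t / 4)] of the series with characteristic 1/2. *)
Definition qfac (t : C) : C := cexp (- (RtoC PI * Ci * RtoC (1 / 4) * t)).

(** Because [(k + 1/2)^2 - 1/4 = k (k + 1)], a nonnegative integer that vanishes exactly at 0 and
    -1. *)
Lemma gterm_half (k : Z) (w t : C) :
  qfac t * gterm (IZR k + 1 / 2) w t =
  cexp (freq (IZR k + 1 / 2) * w) * cexp (RtoC PI * Ci * RtoC (IZR (k * (k + 1))) * t).
Proof.
  unfold qfac, gterm, freq; rewrite <- !cexp_plus; f_equal.
  rewrite mult_IZR, plus_IZR.
  destruct w, t; apply injective_projections; simpl; field.
Qed.

Lemma theta2_cusp (tau : C) : (0 < Im tau)%R ->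
  Ccv (fun n => qfac (dil n tau) * Theta (1 / 2) 0 (dil n tau)) 2.
Proof.
  intros H.
  assert (E : forall t k, qfac t * gterm (IZR k + 1 / 2) 0 t =
    1 * cexp (RtoC PI * Ci * RtoC (IZR (k * (k + 1))) * t)).
  { intros t k; rewrite gterm_half, Cmult_0_r, cexp_0; reflexivity. }
  assert (L := cusp_limit (fun k => 1) (fun k => (k * (k + 1))%Z) tau H).
  cbv beta in L; simpl Z.eqb in L; cbv iota in L.
  replace (1 + 1) with (RtoC 2) in L by (apply injective_projections; simpl; ring).
  eapply Ccv_ext; [|apply L]; try (intros; nia).
  - intros n; unfold Theta; rewrite <- Zsum_scal by (apply gterm_summable, Im_dil_pos, H).
    apply Zsum_ext; intros k; symmetry; apply E.
  - eapply Zsummable_ext; [|apply (Zsummable_scal (qfac tau)), (gterm_summable (1 / 2) 0 tau H)].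
    intros k; apply E.
Qed.

Lemma dtheta1_cusp (tau : C) : (0 < Im tau)%R ->
  Ccv (fun n => qfac (dil n tau) * - dTheta (1 / 2) half (dil n tau)) (2 * RtoC PI).
Proof.
  intros H.
  set (c := fun k : Z => - (freq (IZR k + 1 / 2) * cexp (freq (IZR k + 1 / 2) * half))).
  assert (E : forall t k, - qfac t * (freq (IZR k + 1 / 2) * gterm (IZR k + 1 / 2) half t) =
    c k * cexp (RtoC PI * Ci * RtoC (IZR (k * (k + 1))) * t)).
  { intros t k.
    transitivity (- freq (IZR k + 1 / 2) * (qfac t * gterm (IZR k + 1 / 2) half t)); [ring|].
    rewrite gterm_half; unfold c; ring. }
  assert (L := cusp_limit c (fun k => (k * (k + 1))%Z) tau H).
  cbv beta in L; simpl Z.eqb in L; cbv iota in L.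
  (* The frequencies [PI i] and [- PI i] meet the phases [i] and [- i]; both surviving terms
     therefore equal [PI] instead of cancelling. *)
  assert (C0 : c 0%Z = RtoC PI).
  { unfold c; replace (freq (IZR 0 + 1 / 2) * half) with (freq (1 / 4)).
    - rewrite cexp_freq_quarter; unfold freq; apply injective_projections; simpl; field.
    - unfold freq, half; apply injective_projections; simpl; field. }
  assert (C1 : c (-1)%Z = RtoC PI).
  { unfold c; replace (freq (IZR (-1) + 1 / 2) * half) with (- freq (1 / 4)).
    - rewrite cexp_opp, cexp_freq_quarter; unfold freq.
      apply injective_projections; simpl; field.
    - unfold freq, half; apply injective_projections; simpl; field. }
  rewrite C0, C1 in L.
  replace (RtoC PI + RtoC PI) with (2 * RtoC PI) in L by ring.
  eapply Ccv_ext; [|apply L]; try (intros; nia).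
  - intros n; unfold dTheta.
    replace (qfac (dil n tau) * - Zsum (fun k => freq (IZR k + 1 / 2) * gterm (IZR k + 1 / 2) half (dil n tau)))
      with (- qfac (dil n tau) * Zsum (fun k => freq (IZR k + 1 / 2) * gterm (IZR k + 1 / 2) half (dil n tau))) by ring.
    rewrite <- Zsum_scal by (apply freq_gterm_summable, Im_dil_pos, H).
    apply Zsum_ext; intros k; symmetry; apply E.
  - eapply Zsummable_ext; [|apply (Zsummable_scal (- qfac tau)), (freq_gterm_summable (1 / 2) half tau H)].
    intros k; apply E.
Qed.

Lemma Ccv_eventually_neq_0 (u : nat -> C) (l : C) :
  Ccv u l -> l <> 0 -> exists N, forall n, (N <= n)%nat -> u n <> 0.
Proof.
  intros H Hl.
  assert (P := proj1 (Cmod_gt_0 l) Hl).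
  destruct (proj1 (is_lim_seq_0_iff _ (fun n => Cmod_ge_0 _)) H (Cmod l) P) as [N HN].
  exists N; intros n Hn E; specialize (HN n Hn); rewrite E in HN.
  replace (0 - l) with (- l) in HN by ring; rewrite Cmod_opp in HN; lra.
Qed.

(** At [z = 0] the product formulas read [theta3 theta4 (tau) = theta4 (2 tau)^2] and
    [theta2 (tau)^2 = 2 theta2 theta3 (2 tau)]. Nonvanishing at [2 tau] thus passes to [tau], and it
    holds far along the sequence because the limits are nonzero. *)
Lemma theta_constants_neq_0 (tau : C) : (0 < Im tau)%R ->
  Theta (1 / 2) 0 tau <> 0 /\ Theta 0 0 tau <> 0 /\ Theta 0 half tau <> 0.
Proof.
  intros H.
  assert (D : forall n t, (0 < Im t)%R ->
    Theta (1 / 2) 0 (dil n t) <> 0 /\ Theta 0 0 (dil n t) <> 0 /\ Theta 0 half (dil n t) <> 0 ->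
    Theta (1 / 2) 0 t <> 0 /\ Theta 0 0 t <> 0 /\ Theta 0 half t <> 0).
  { induction n as [|n IH]; intros t Ht; [rewrite dil_0; auto|].
    rewrite dil_S; intros Hn; destruct (IH _ (Im_double_pos t Ht) Hn) as [h2 [h3 h4]].
    assert (E := theta34 0 t Ht).
    replace (0 + half) with half in E by ring.
    replace (2 * 0 + half) with half in E by ring.
    assert (E2 := theta22 t Ht).
    repeat split; intros Z.
    - rewrite Z, Cmult_0_l in E2; revert E2.
      apply not_eq_sym, Cmult_neq_0; [intros Z'; injection Z'; lra|].
      apply Cmult_neq_0; assumption.
    - rewrite Z, Cmult_0_l in E; revert E; apply not_eq_sym, Cmult_neq_0; assumption.
    - rewrite Z, Cmult_0_r in E; revert E; apply not_eq_sym, Cmult_neq_0; assumption. }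
  assert (one : RtoC 1 <> 0) by (intros Z; injection Z; lra).
  assert (two : RtoC 2 <> 0) by (intros Z; injection Z; lra).
  destruct (Ccv_eventually_neq_0 _ _ (theta2_cusp tau H) two) as [N2 h2].
  destruct (Ccv_eventually_neq_0 _ _ (theta0_cusp 0 tau H) one) as [N3 h3].
  destruct (Ccv_eventually_neq_0 _ _ (theta0_cusp half tau H) one) as [N4 h4].
  apply (D (N2 + N3 + N4)%nat tau H); repeat split.
  - intros Z; apply (h2 (N2 + N3 + N4)%nat); [lia|]. rewrite Z; ring.
  - apply h3; lia.
  - apply h4; lia.
Qed.

(* The quotient of the two sides is invariant under [tau -> 2 tau], and it tends
   to 1 at the cusp. *)
Lemma jacobi_derivative (tau : C) : (0 < Im tau)%R ->
  - dTheta (1 / 2) half tau = RtoC PI * (Theta (1 / 2) 0 tau * Theta 0 0 tau * Theta 0 half tau).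
Proof.
  intros H.
  set (E := fun t => - dTheta (1 / 2) half t).
  set (R := fun t => Theta (1 / 2) 0 t * Theta 0 0 t * Theta 0 half t).
  assert (NR : forall t, (0 < Im t)%R -> R t <> 0).
  { intros t Ht; destruct (theta_constants_neq_0 t Ht) as [h2 [h3 h4]].
    apply Cmult_neq_0; [apply Cmult_neq_0|]; assumption. }
  assert (step : forall t, (0 < Im t)%R -> E (2 * t) * R t = E t * R (2 * t)).
  { intros t Ht.
    (* At zero, [wronskian12] says [theta1' theta2 (t) = 2 theta1' theta4 (2 t)]. With the two
       product formulas, both cross products reduce to the same expression. *)
    assert (L1 := theta34 0 t Ht). assert (L2 := theta22 t Ht).
    assert (L3 := wronskian12 0 t Ht).
    replace (0 + half) with half in L1, L3 by ring.
    replace (2 * 0 + half) with half in L1, L3 by ring.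
    rewrite Theta_half_half in L3 by exact Ht.
    unfold E, R.
    set (x2 := Theta (1 / 2) 0 t) in *; set (x3 := Theta 0 0 t) in *; set (x4 := Theta 0 half t) in *.
    set (y2 := Theta (1 / 2) 0 (2 * t)) in *; set (y3 := Theta 0 0 (2 * t)) in *.
    set (y4 := Theta 0 half (2 * t)) in *.
    set (d := dTheta (1 / 2) half t) in *; set (e := dTheta (1 / 2) half (2 * t)) in *.
    assert (two : RtoC 2 <> 0) by (intros Z; injection Z; lra).
    transitivity (- (2 * (e * y4)) * (x2 * y4) / 2).
    - replace (x2 * x3 * x4) with (x2 * (x3 * x4)) by ring; rewrite L1; field; exact two.
    - rewrite <- L3.
      replace (y2 * y3 * y4) with (2 * (y2 * y3) * y4 / 2) by (field; exact two).
      rewrite <- L2; field; exact two. }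
  assert (all : forall n t, (0 < Im t)%R -> E (dil n t) * R t = E t * R (dil n t)).
  { induction n as [|n IH]; intros t Ht; [rewrite dil_0; reflexivity|].
    assert (H2 := Im_double_pos t Ht). assert (N := NR _ H2).
    rewrite dil_S; specialize (IH _ H2); specialize (step t Ht).
    transitivity (E (dil n (2 * t)) * R (2 * t) * R t / R (2 * t)); [field; exact N|].
    rewrite IH.
    transitivity (E (2 * t) * R t * R (dil n (2 * t)) / R (2 * t)); [field; exact N|].
    rewrite step; field; exact N. }
  assert (A := Ccv_mult _ _ _ _ (dtheta1_cusp tau H) (Ccv_const (R tau))).
  assert (B := Ccv_mult _ _ _ _ (Ccv_const (E tau)) (Ccv_mult _ _ _ _
     (Ccv_mult _ _ _ _ (theta2_cusp tau H) (theta0_cusp 0 tau H)) (theta0_cusp half tau H))).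
  assert (two : RtoC 2 <> 0) by (intros Z; injection Z; lra).
  (* One sequence, [qfac] times either cross product, has both limits. *)
  assert (F : 2 * RtoC PI * R tau = E tau * (2 * 1 * 1)).
  { eapply Ccv_unique; [exact A|]. eapply Ccv_ext; [|exact B].
    intros n; simpl.
    transitivity (qfac (dil n tau) * (E tau * R (dil n tau))); [unfold R; ring|].
    rewrite <- all by exact H; unfold E; ring. }
  fold (E tau); fold (R tau).
  transitivity (E tau * (2 * 1 * 1) / 2); [field; exact two|].
  rewrite <- F; field; exact two.
Qed.

(** * The Wronskians of theta functions with theta1 *)

(* [W] and [G] are proportional to a common [F], and Jacobi's formula fixes the
   factor at [0]. *)
Lemma proportional_at_0 (W G F : C -> C) (A B z v vy vz : C) :
  (forall z, W z = A * F z) -> (forall z, G z = B * F z) ->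
  G 0 = vy * vz -> vy <> 0 -> vz <> 0 ->
  W 0 = - (RtoC PI * (v * vy * vz)) * v ->
  W z = - (RtoC PI * (v * v)) * G z.
Proof.
  intros HW HG G0 Ny Nz W0.
  assert (N : G 0 <> 0) by (rewrite G0; apply Cmult_neq_0; assumption).
  assert (E : W z * G 0 = W 0 * G z) by (rewrite !HW, !HG; ring).
  transitivity (W z * G 0 / G 0); [field; exact N|].
  rewrite E, W0, G0; field; split; assumption.
Qed.

(** Case [X = 2]. The minus sign on the right appears because [Theta (1/2) (z + half)] is
    [- theta1]. *)
Lemma wronskian12_eq (z tau : C) : (0 < Im tau)%R ->
  dTheta (1 / 2) (z + half) tau * Theta (1 / 2) z tau - Theta (1 / 2) (z + half) tau * dTheta (1 / 2) z tau
  = - (RtoC PI * (Theta (1 / 2) 0 tau * Theta (1 / 2) 0 tau)) * (Theta 0 z tau * Theta 0 (z + half) tau).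
Proof.
  intros H; destruct (theta_constants_neq_0 tau H) as [h2 [h3 h4]].
  apply (proportional_at_0
    (fun z => dTheta (1 / 2) (z + half) tau * Theta (1 / 2) z tau - Theta (1 / 2) (z + half) tau * dTheta (1 / 2) z tau)
    (fun z => Theta 0 z tau * Theta 0 (z + half) tau) (fun z => Theta 0 (2 * z + half) (2 * tau))
    (2 * dTheta (1 / 2) half (2 * tau)) (Theta 0 half (2 * tau)) z
    (Theta (1 / 2) 0 tau) (Theta 0 0 tau) (Theta 0 half tau)); auto.
  - intros x; rewrite wronskian12 by exact H; ring.
  - intros x; apply theta34, H.
  - rewrite Cplus_0_l; reflexivity.
  - rewrite Cplus_0_l, Theta_half_half, <- jacobi_derivative by exact H; ring.
Qed.

Lemma wronskian13_eq (z tau : C) : (0 < Im tau)%R ->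
  dTheta (1 / 2) (z + half) tau * Theta 0 z tau - Theta (1 / 2) (z + half) tau * dTheta 0 z tau
  = - (RtoC PI * (Theta 0 0 tau * Theta 0 0 tau)) * (Theta (1 / 2) z tau * Theta 0 (z + half) tau).
Proof.
  intros H; destruct (theta_constants_neq_0 tau H) as [h2 [h3 h4]].
  apply (proportional_at_0
    (fun z => dTheta (1 / 2) (z + half) tau * Theta 0 z tau - Theta (1 / 2) (z + half) tau * dTheta 0 z tau)
    (fun z => Theta (1 / 2) z tau * Theta 0 (z + half) tau)
    (fun z => Theta (1 / 4) (2 * z + half) (2 * tau) + Ci * Theta (3 / 4) (2 * z + half) (2 * tau))
    (2 * dTheta (1 / 4) half (2 * tau)) (Theta (1 / 4) (- half) (2 * tau)) z
    (Theta 0 0 tau) (Theta (1 / 2) 0 tau) (Theta 0 half tau)); auto.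
  - intros x; apply wronskian13, H.
  - intros x; apply theta24, H.
  - rewrite Cplus_0_l; reflexivity.
  - rewrite Cplus_0_l, Theta_half_half by exact H.
    rewrite (Cmult_comm (Theta 0 0 tau)), <- jacobi_derivative by exact H; ring.
Qed.

Lemma wronskian14_eq (z tau : C) : (0 < Im tau)%R ->
  dTheta (1 / 2) (z + half) tau * Theta 0 (z + half) tau - Theta (1 / 2) (z + half) tau * dTheta 0 (z + half) tau
  = - (RtoC PI * (Theta 0 half tau * Theta 0 half tau)) * (Theta (1 / 2) z tau * Theta 0 z tau).
Proof.
  intros H; destruct (theta_constants_neq_0 tau H) as [h2 [h3 h4]].
  apply (proportional_at_0
    (fun z => dTheta (1 / 2) (z + half) tau * Theta 0 (z + half) tau - Theta (1 / 2) (z + half) tau * dTheta 0 (z + half) tau)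
    (fun z => Theta (1 / 2) z tau * Theta 0 z tau)
    (fun z => Theta (1 / 4) (2 * z) (2 * tau) + Theta (3 / 4) (2 * z) (2 * tau))
    (2 * Ci * dTheta (1 / 4) 0 (2 * tau)) (Theta (1 / 4) 0 (2 * tau)) z
    (Theta 0 half tau) (Theta (1 / 2) 0 tau) (Theta 0 0 tau)); auto.
  - intros x; apply wronskian14, H.
  - intros x; apply theta23, H.
  - rewrite Cplus_0_l, Theta_half_half by exact H.
    replace (Theta 0 half tau * Theta (1 / 2) 0 tau * Theta 0 0 tau)
      with (Theta (1 / 2) 0 tau * Theta 0 0 tau * Theta 0 half tau) by ring.
    rewrite <- jacobi_derivative by exact H; ring.
Qed.

(** * Arbitrary integer characteristics and half-period shifts *)

Lemma gterm_Zperiod (a j k : Z) (w tau : C) :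
  gterm (IZR k + IZR a / 2) (w + RtoC (IZR j)) tau =
  sgnZ (a * j) * gterm (IZR k + IZR a / 2) w tau.
Proof.
  replace (sgnZ (a * j)) with (sgnZ (2 * (k * j) + a * j)).
  2: { unfold sgnZ; rewrite Z.add_comm, Z.even_add_mul_2; reflexivity. }
  rewrite <- cexp_Zhalf; unfold gterm; rewrite <- cexp_plus; f_equal.
  rewrite plus_IZR, !mult_IZR.
  destruct w, tau; apply injective_projections; simpl; field.
Qed.

Lemma Theta_Zperiod (a j : Z) (w tau : C) : (0 < Im tau)%R ->
  Theta (IZR a / 2) (w + RtoC (IZR j)) tau = sgnZ (a * j) * Theta (IZR a / 2) w tau.
Proof.
  intros H; unfold Theta; rewrite <- Zsum_scal by (apply gterm_summable; exact H).
  apply Zsum_ext; intros k; apply gterm_Zperiod.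
Qed.

Lemma dTheta_Zperiod (a j : Z) (w tau : C) : (0 < Im tau)%R ->
  dTheta (IZR a / 2) (w + RtoC (IZR j)) tau = sgnZ (a * j) * dTheta (IZR a / 2) w tau.
Proof.
  intros H; unfold dTheta; rewrite <- Zsum_scal by (apply freq_gterm_summable; exact H).
  apply Zsum_ext; intros k; rewrite gterm_Zperiod; ring.
Qed.

Lemma sgnZ_sqr (k : Z) : sgnZ k * sgnZ k = 1.
Proof. unfold sgnZ; destruct (Z.even k); ring. Qed.

Lemma Theta_mod2 (i r : Z) (w tau : C) : (0 < Im tau)%R ->
  Theta (IZR (2 * i + r) / 2) w tau = Theta (IZR r / 2) w tau.
Proof.
  intros H; rewrite <- (Theta_char_shift (IZR r / 2) i) by exact H; f_equal.
  rewrite plus_IZR, mult_IZR; field.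
Qed.

Lemma dTheta_mod2 (i r : Z) (w tau : C) : (0 < Im tau)%R ->
  dTheta (IZR (2 * i + r) / 2) w tau = dTheta (IZR r / 2) w tau.
Proof.
  intros H; rewrite <- (dTheta_char_shift (IZR r / 2) i) by exact H; f_equal.
  rewrite plus_IZR, mult_IZR; field.
Qed.

(** [Theta] depends on [a] only modulo 2, while shifting [b] by 2 can cost a sign. So [b] enters
    here through its residue [s] alone, and the sign is restored in [wronskian_theta]. *)
Lemma wronskian_reduced (a s : Z) (z tau : C) : (0 < Im tau)%R -> (s = 0 \/ s = 1)%Z ->
  dTheta (1 / 2) (z + half) tau * Theta (IZR a / 2) (z + RtoC (IZR s / 2)) tau
  - Theta (1 / 2) (z + half) tau * dTheta (IZR a / 2) (z + RtoC (IZR s / 2)) tau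
  = - (RtoC PI * (Theta (IZR a / 2) (RtoC (IZR s / 2)) tau * Theta (IZR a / 2) (RtoC (IZR s / 2)) tau))
    * (Theta (IZR (a - 1) / 2) z tau * Theta 0 (z + RtoC (IZR (s - 1) / 2)) tau).
Proof.
  intros H Hs.
  assert (R0 : RtoC (0 / 2) = 0) by (f_equal; field).
  assert (Rm : Theta 0 (z + RtoC (-1 / 2)) tau = Theta 0 (z + half) tau).
  { replace (z + half) with (z + RtoC (-1 / 2) + 1)
      by (unfold half; destruct z; apply injective_projections; simpl; field).
    rewrite Theta_period, cexp_freq_0 by exact H; ring. }
  assert (Tm : Theta (-1 / 2) z tau = Theta (1 / 2) z tau).
  { rewrite <- (Theta_char_shift (-1 / 2) 1) by exact H; f_equal; simpl; field. }
  assert (O0 : (0 / 2)%R = 0%R) by field.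
  rewrite (Z.div_mod a 2) by lia; set (i := (a / 2)%Z).
  assert (Hr : (a mod 2 = 0 \/ a mod 2 = 1)%Z) by (generalize (Z.mod_pos_bound a 2); lia).
  replace (2 * i + a mod 2 - 1)%Z with (2 * i + (a mod 2 - 1))%Z by ring.
  rewrite !Theta_mod2, !dTheta_mod2 by exact H.
  fold half.
  destruct Hr as [-> | ->], Hs as [-> | ->]; simpl Z.sub; rewrite ?R0, ?O0, ?Rm, ?Tm, ?Cplus_0_r; fold half.
  - apply wronskian13_eq, H.
  - apply wronskian14_eq, H.
  - apply wronskian12_eq, H.
  (* Both characteristics odd: the Wronskian of [theta1] with itself against a vanishing theta
     constant. *)
  - rewrite Theta_half_half by exact H; ring.
Qed.

Lemma wronskian_theta (a b : Z) (z tau : C) : (0 < Im tau)%R ->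
  dTheta (1 / 2) (z + half) tau * theta a b z tau
  - Theta (1 / 2) (z + half) tau * dTheta (IZR a / 2) (z + RtoC (IZR b / 2)) tau
  = - (sgnZ (a * (b / 2)) * RtoC PI * (vartheta a b tau * vartheta a b tau)
       * theta (a - 1) 0 z tau * theta 0 (b - 1) z tau).
Proof.
  intros H; unfold vartheta; rewrite !theta_Theta.
  set (j := (b / 2)%Z); set (s := (b mod 2)%Z).
  assert (Eb : b = (2 * j + s)%Z) by (apply Z.div_mod; lia).
  assert (Hs : (s = 0 \/ s = 1)%Z) by (generalize (Z.mod_pos_bound b 2); lia).
  assert (C0 := wronskian_reduced a s z tau H Hs).
  replace (z + RtoC (IZR b / 2)) with (z + RtoC (IZR s / 2) + RtoC (IZR j))
    by (rewrite Eb, plus_IZR, mult_IZR; destruct z; apply injective_projections; simpl; field).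
  replace (0 + RtoC (IZR b / 2)) with (RtoC (IZR s / 2) + RtoC (IZR j))
    by (rewrite Eb, plus_IZR, mult_IZR; apply injective_projections; simpl; field).
  replace (z + RtoC (IZR (b - 1) / 2)) with (z + RtoC (IZR (s - 1) / 2) + RtoC (IZR j))
    by (rewrite Eb, !minus_IZR, plus_IZR, mult_IZR; destruct z; apply injective_projections; simpl; field).
  replace (z + RtoC (0 / 2)) with z
    by (destruct z; apply injective_projections; simpl; field).
  rewrite !Theta_Zperiod, dTheta_Zperiod by exact H.
  replace (sgnZ (0 * j)) with (RtoC 1) by reflexivity.
  replace (IZR 0 / 2)%R with 0%R by (simpl; field).
  set (e := sgnZ (a * j)) in *; assert (Ee : e * e = 1) by apply sgnZ_sqr.
  (* The sign [e] occurs once on the left. On the right it occurs three times: the explicit sign and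
     both factors of the squared theta constant; the factor with characteristic 0 contributes
     none. *)
  match type of C0 with ?L = ?R => transitivity (e * L); [ring | rewrite C0] end.
  clearbody e.
  generalize (Theta (IZR a / 2) (RtoC (IZR s / 2)) tau) (Theta (IZR (a - 1) / 2) z tau)
    (Theta 0 (z + RtoC (IZR (s - 1) / 2)) tau); intros X Y V.
  transitivity (- (e * (e * e) * RtoC PI * (X * X) * Y * V)); [rewrite Ee; ring | ring].
Qed.

(** Completing the square moves [m tau / 2] into the characteristic at the price of a phase
    independent of [k]. The frequency changes by [- PI i m], which is the source of the correction
    term. *)
Lemma dTheta_quasi_period (a b m n : Z) (z tau : C) : (0 < Im tau)%R ->
  dTheta (IZR a / 2) (z + RtoC (IZR n / 2) + RtoC (IZR m / 2) * tau + RtoC (IZR b / 2)) tau =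
  Cpowz Ci (- (m * (b + n)))
  * cexp (- (RtoC (1/4) * RtoC PI * Ci * RtoC (IZR m) * (4 * z + RtoC (IZR m) * tau)))
  * (dTheta (IZR (a + m) / 2) (z + RtoC (IZR (b + n) / 2)) tau
     - RtoC PI * Ci * RtoC (IZR m) * theta (a + m) (b + n) z tau).
Proof.
  intros H; rewrite theta_Theta, cexp_Zquarter, <- cexp_plus.
  set (p := cexp _); unfold Theta, dTheta.
  assert (S := gterm_summable (IZR (a + m) / 2) (z + RtoC (IZR (b + n) / 2)) tau H).
  assert (F := freq_gterm_summable (IZR (a + m) / 2) (z + RtoC (IZR (b + n) / 2)) tau H).
  match goal with |- _ = p * (?A - ?c * ?B) =>
    replace (p * (A - c * B)) with (p * (A + - c * B)) by ring end.
  rewrite <- Zsum_scal, <- Zsum_plus, <- Zsum_scal;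
    auto using Zsummable_plus, Zsummable_scal.
  apply Zsum_ext; intros k.
  replace (gterm (IZR k + IZR a / 2) _ tau) with
    (p * gterm (IZR k + IZR (a + m) / 2) (z + RtoC (IZR (b + n) / 2)) tau).
  - replace (freq (IZR k + IZR a / 2)) with
      (freq (IZR k + IZR (a + m) / 2) - RtoC PI * Ci * RtoC (IZR m)); [ring|].
    unfold freq; rewrite plus_IZR; apply injective_projections; simpl; field.
  - unfold p, gterm; rewrite <- cexp_plus; f_equal.
    rewrite opp_IZR, mult_IZR, !plus_IZR.
    destruct z, tau; apply injective_projections; simpl; field.
Qed.

Theorem theorem6p1 (a b m n : Z) (tau z : C) :
  (0 < Im tau)%R ->
  theta1 z tau <> 0 ->
  theta' a b (z + RtoC (IZR n / 2) + RtoC (IZR m / 2) * tau) tau =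
  Cpowz Ci (- (m * (b + n)))%Z
  * cexp (- (RtoC (1/4) * RtoC PI * Ci * RtoC (IZR m)
              * (4 * z + RtoC (IZR m) * tau)))
  / theta1 z tau
  * ((theta1' z tau - RtoC PI * Ci * RtoC (IZR m) * theta1 z tau)
       * theta (a + m) (b + n) z tau
     - sgnZ ((a + m) * Z.div (b + n) 2)%Z * RtoC PI
       * (vartheta (a + m) (b + n) tau * vartheta (a + m) (b + n) tau)
       * theta (a + m - 1) 0 z tau * theta 0 (b + n - 1) z tau).
Proof.
  intros H N.
  rewrite theta'_dTheta, dTheta_quasi_period, theta1'_dTheta by exact H.
  (* The subtracted product is the right side of [wronskian_theta]. Substituting the Wronskian
     cancels the terms in [theta1'], and what remains is divisible by [theta1]. *)
  unfold Cminus at 2; rewrite <- wronskian_theta by exact H.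
  change (theta1 z tau) with (- Theta (1 / 2) (z + half) tau) in *.
  fold half; field.
  intros E; apply N; rewrite E; ring.
Qed.
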